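(* Let $M(\phi,\xi,\eta,g_M)$ be a cosymplectic manifold, $(N,g_N)$ a Riemannian manifold, and $F:M\to N$ a Riemannian submersion such that $(\ker F_* )^\perp=\phi(\ker F_* )\oplus\{\xi\}$. Then the horizontal distribution $(\ker F_* )^\perp$ is integrable and totally geodesic.
   Context: An almost contact metric structure $(\phi,\xi,\eta,g_M)$ on an odd-dimensional manifold $M$ consists of a $(1,1)$-tensor $\phi$, a vector field $\xi$, a $1$-form $\eta$ and a Riemannian metric $g_M$ with $\phi^2=-I+\eta\otimes\xi$, $\phi\xi=0$, $\eta\circ\phi=0$, $\eta(\xi)=1$, $g_M(\phi X,\phi Y)=g_M(X,Y)-\eta(X)\eta(Y)$, $\eta(X)=g_M(X,\xi)$. It is cosymplectic if it is normal and $\eta$ and $\Phi(X,Y)=g_M(X,\phi Y)$ are closed; the structure equation is $\nabla\phi=0$, and then $\nabla\xi=0$ ($\nabla$ the Levi-Civita connection of $g_M$). A Riemannian submersion $F:(M,g_M)\to(N,g_N)$ is a smooth surjective map of maximal rank such that $F_*$ preserves the lengths of vectors in $(\ker F_* )^\perp$. Here $\{\xi\}$ denotes the line distribution spanned by $\xi$. A distribution $D$ is totally geodesic if $\nabla_XY\in\Gamma(D)$ for all $X,Y\in\Gamma(D)$. *)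

(* Defs.v *)
From HB Require Import structures.
From mathcomp Require Import all_boot all_order all_algebra.
From mathcomp Require Import all_classical all_reals all_analysis.
Set Implicit Arguments.
Unset Strict Implicit.
Unset Printing Implicit Defensive.
Import Order.TTheory GRing.Theory Num.Theory.
Import numFieldNormedType.Exports.
Local Open Scope classical_set_scope.
Local Open Scope ring_scope.

Section Smooth.
Context {R : realType} {n : nat}.
Implicit Types (f : 'rV[R]_n -> R) (U : set 'rV[R]_n).

Definition iter_partial (s : seq 'I_n) f : 'rV[R]_n -> R :=
  foldr (fun i g => 'D_(delta_mx 0 i) g) f s.

(* Smoothness on an open set [U]; the values of [f] outside [U] are
   irrelevant. *)
Definition smooth_on U f : Prop :=
  forall s x, U x -> differentiable (iter_partial s f) x.

End Smooth.

(* [cmap] and [cinv] are total functions, meaningful only on [cdom] and on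
   [cmap @` cdom] respectively. *)
Record chart (R : realType) (n : nat) (T : topologicalType) := Chart {
  cdom : set T;
  cmap : T -> 'rV[R]_n;
  cinv : 'rV[R]_n -> T;
  cdom_open : open cdom;
  cimage_open : open (cmap @` cdom);
  cmapK : forall p, cdom p -> cinv (cmap p) = p;
  cmap_continuous : forall p, cdom p -> {for p, continuous cmap};
  cinv_continuous : forall x, (cmap @` cdom) x -> {for x, continuous cinv}
}.

(* The smooth structure is the one generated by [atlas], which need not be
   maximal. *)
Record smooth_manifold (R : realType) (n : nat) := SmoothManifold {
  space :> topologicalType;
  space_hausdorff : hausdorff_space space;
  space_second_countable : @second_countable space;
  atlas : set (chart R n space);
  atlas_cover : forall p, exists2 c, atlas c & cdom c p;
  atlas_smooth : forall c d j, atlas c -> atlas d ->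
    smooth_on (cmap c @` (cdom c `&` cdom d))
              (fun x => cmap d (cinv c x) 0 j)
}.

Definition smooth_map {R : realType} {m n : nat}
    {M : smooth_manifold R m} {N : smooth_manifold R n} (F : M -> N) : Prop :=
  continuous F /\
  forall c d j, atlas c -> atlas d ->
    smooth_on (cmap c @` (cdom c `&` F @^-1` cdom d))
              (fun x => cmap d (F (cinv c x)) 0 j).

Section Tensors.
Context {R : realType} {n : nat} (M : smooth_manifold R n).

Definition smooth_fun (f : M -> R) : Prop :=
  forall c, atlas c -> smooth_on (cmap c @` cdom c) (f \o cinv c).

(* Ambient vector space of all tangent spaces. *)
Definition functional := (M -> R) -> R^o.

(* The tangent space at [p] is the space of derivations at [p] of the algebra
   of smooth functions.  A derivation is extended by [0] to non-smooth
   functions, so that equality of tangent vectors is equality in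
   [functional]. *)
Record tangent (p : M) (v : functional) : Prop := Tangent {
  tangent_junk : forall f, ~ smooth_fun f -> v f = 0;
  tangent_linear : forall (a : R) f g, smooth_fun f -> smooth_fun g ->
    v (fun q => a * f q + g q) = a * v f + v g;
  tangent_leibniz : forall f g, smooth_fun f -> smooth_fun g ->
    v (fun q => f q * g q) = f p * v g + g p * v f
}.

Definition field := M -> functional.

Record vector_field (X : field) : Prop := VectorField {
  vector_field_tangent : forall p, tangent p (X p);
  vector_field_smooth : forall f, smooth_fun f -> smooth_fun (fun p => X p f)
}.

Definition bracket (X Y : field) : field :=
  fun p f => X p (fun q => Y q f) - Y p (fun q => X q f).

(* Tensors are given by their pointwise values; only the values on tangent
   vectors at the given point are meaningful. *)
Record one_form (eta : M -> functional -> R) : Prop := OneForm {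
  one_form_linear : forall p (a : R) v w, tangent p v -> tangent p w ->
    eta p (a *: v + w) = a * eta p v + eta p w;
  one_form_smooth : forall X, vector_field X ->
    smooth_fun (fun p => eta p (X p))
}.

Record endo_field (phi : M -> functional -> functional) : Prop := EndoField {
  endo_field_tangent : forall p v, tangent p v -> tangent p (phi p v);
  endo_field_linear : forall p (a : R) v w, tangent p v -> tangent p w ->
    phi p (a *: v + w) = a *: phi p v + phi p w;
  endo_field_smooth : forall X, vector_field X ->
    vector_field (fun p => phi p (X p))
}.

Record riemannian_metric (g : M -> functional -> functional -> R) : Prop :=
  RiemannianMetric {
  metric_linear : forall p (a : R) u v w,
    tangent p u -> tangent p v -> tangent p w ->
    g p (a *: u + v) w = a * g p u w + g p v w;
  metric_sym : forall p v w, tangent p v -> tangent p w -> g p v w = g p w v;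
  metric_pos : forall p v, tangent p v -> v != 0 -> 0 < g p v v;
  metric_smooth : forall X Y, vector_field X -> vector_field Y ->
    smooth_fun (fun p => g p (X p) (Y p))
}.

Record levi_civita (g : M -> functional -> functional -> R)
    (nabla : field -> field -> field) : Prop := LeviCivita {
  lc_field : forall X Y, vector_field X -> vector_field Y ->
    vector_field (nabla X Y);
  lc_linearl : forall f X X' Y,
    smooth_fun f -> vector_field X -> vector_field X' -> vector_field Y ->
    forall p, nabla (fun q => f q *: X q + X' q) Y p =
              f p *: nabla X Y p + nabla X' Y p;
  lc_addr : forall X Y Y',
    vector_field X -> vector_field Y -> vector_field Y' ->
    forall p, nabla X (fun q => Y q + Y' q) p = nabla X Y p + nabla X Y' p;
  lc_leibniz : forall f X Y,
    smooth_fun f -> vector_field X -> vector_field Y ->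
    forall p, nabla X (fun q => f q *: Y q) p =
              X p f *: Y p + f p *: nabla X Y p;
  lc_torsion_free : forall X Y, vector_field X -> vector_field Y ->
    forall p, nabla X Y p - nabla Y X p = bracket X Y p;
  lc_metric : forall X Y Z,
    vector_field X -> vector_field Y -> vector_field Z ->
    forall p, X p (fun q => g q (Y q) (Z q)) =
              g p (nabla X Y p) (Z p) + g p (Y p) (nabla X Z p)
}.

Record almost_contact_metric (phi : M -> functional -> functional)
    (xi : field) (eta : M -> functional -> R)
    (g : M -> functional -> functional -> R) : Prop := AlmostContactMetric {
  acm_phi : endo_field phi;
  acm_xi : vector_field xi;
  acm_eta : one_form eta;
  acm_g : riemannian_metric g;
  acm_phi2 : forall p v, tangent p v ->
    phi p (phi p v) = - v + eta p v *: xi p;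
  acm_phi_xi : forall p, phi p (xi p) = 0;
  acm_eta_phi : forall p v, tangent p v -> eta p (phi p v) = 0;
  acm_eta_xi : forall p, eta p (xi p) = 1;
  acm_compatible : forall p v w, tangent p v -> tangent p w ->
    g p (phi p v) (phi p w) = g p v w - eta p v * eta p w;
  acm_eta_g : forall p v, tangent p v -> eta p v = g p v (xi p)
}.

(* Exterior derivatives, without the normalizing factors 1/2 and 1/3. *)
Definition d1 (eta : M -> functional -> R) (X Y : field) (p : M) : R :=
  X p (fun q => eta q (Y q)) - Y p (fun q => eta q (X q))
  - eta p (bracket X Y p).

Definition d2 (Phi : M -> functional -> functional -> R) (X Y Z : field)
    (p : M) : R :=
  X p (fun q => Phi q (Y q) (Z q)) + Y p (fun q => Phi q (Z q) (X q))
  + Z p (fun q => Phi q (X q) (Y q))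
  - Phi p (bracket X Y p) (Z p) - Phi p (bracket Y Z p) (X p)
  - Phi p (bracket Z X p) (Y p).

Definition closed1 (eta : M -> functional -> R) : Prop :=
  forall X Y, vector_field X -> vector_field Y -> forall p, d1 eta X Y p = 0.

Definition closed2 (Phi : M -> functional -> functional -> R) : Prop :=
  forall X Y Z, vector_field X -> vector_field Y -> vector_field Z ->
  forall p, d2 Phi X Y Z p = 0.

Definition nijenhuis (phi : M -> functional -> functional) (X Y : field) :
    field :=
  fun p =>
    phi p (phi p (bracket X Y p))
    + bracket (fun q => phi q (X q)) (fun q => phi q (Y q)) p
    - phi p (bracket (fun q => phi q (X q)) Y p)
    - phi p (bracket X (fun q => phi q (Y q)) p).

(* This is [[phi, phi] + 2 d eta (x) xi = 0] for the convention
   [2 d eta (X, Y) = X eta(Y) - Y eta(X) - eta([X, Y])], which is [d1]. *)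
Definition normal_structure (phi : M -> functional -> functional)
    (xi : field) (eta : M -> functional -> R) : Prop :=
  forall X Y, vector_field X -> vector_field Y ->
  forall p, nijenhuis phi X Y p + d1 eta X Y p *: xi p = 0.

Record cosymplectic (phi : M -> functional -> functional)
    (xi : field) (eta : M -> functional -> R)
    (g : M -> functional -> functional -> R) : Prop := Cosymplectic {
  cosymplectic_acm : almost_contact_metric phi xi eta g;
  cosymplectic_normal : normal_structure phi xi eta;
  cosymplectic_eta : closed1 eta;
  cosymplectic_Phi : closed2 (fun p v w => g p v (phi p w))
}.

Definition section_of (D : M -> set functional) (X : field) : Prop :=
  vector_field X /\ forall p, D p (X p).

(* Integrability in the sense of the bracket condition: the sections of [D] are
   closed under the Lie bracket. *)
Definition integrable_distribution (D : M -> set functional) : Prop :=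
  forall X Y, section_of D X -> section_of D Y -> section_of D (bracket X Y).

Definition totally_geodesic (nabla : field -> field -> field)
    (D : M -> set functional) : Prop :=
  forall X Y, section_of D X -> section_of D Y -> section_of D (nabla X Y).

Definition vlength (g : M -> functional -> functional -> R) (p : M)
    (v : functional) : R := Num.sqrt (g p v v).

Definition line (xi : field) (p : M) : set functional :=
  [set a *: xi p | a in [set: R]].

(* Internal direct sum [A = B (+) C]. *)
Definition direct_sum (A B C : set functional) : Prop :=
  A = [set b + c | b in B & c in C] /\ B `&` C = [set 0].

End Tensors.

Section Submersion.
Context {R : realType} {m n : nat}.
Context {M : smooth_manifold R m} {N : smooth_manifold R n}.
Implicit Types (F : M -> N) (gM : M -> functional M -> functional M -> R).

(* [F_*] at [p]; it does not mention [p] because a derivation at [p] is sent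
   to the derivation [h |-> v (h o F)] at [F p]. *)
Definition pushforward F (v : functional M) : functional N :=
  fun h => if `[< smooth_fun h >] then v (h \o F) else 0.

Definition vertical F (p : M) : set (functional M) :=
  [set v | tangent p v /\ pushforward F v = 0].

Definition horizontal F gM (p : M) : set (functional M) :=
  [set v | tangent p v /\ forall w, vertical F p w -> gM p v w = 0].

Record riemannian_submersion F gM
    (gN : N -> functional N -> functional N -> R) : Prop :=
  RiemannianSubmersion {
  rsub_smooth : smooth_map F;
  rsub_surj : forall q, exists p, F p = q;
  rsub_rank : forall p w, tangent (F p) w ->
    exists2 v, tangent p v & pushforward F v = w;
  rsub_isometry : forall p v, horizontal F gM p v ->
    vlength gN (F p) (pushforward F v) = vlength gM p v
}.

End Submersion.

(* Main.v *)
(* Let H be the horizontal distribution and T (X, Y, Z) = g (nabla_X Y, phi Z) for X,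
   Y, Z in H.  Normality and the closedness of eta and Phi give nabla phi = 0; as phi
   maps H to the vertical distribution, T is then symmetric in (Y, Z).  For a
   Riemannian submersion, vertical fields V satisfy V g (X, X) = 2 g ([V, X], X) on
   H, which makes T skew in (X, Y).  Hence T = 0, and since a vertical w equals
   - phi (phi w) with phi w in H, nabla_X Y is horizontal.

   The arguments on vectors need extensions to smooth sections.  Tangent vectors being
   derivations, Hadamard's lemma and bump functions provide local frames; the
   gradients of the functions y o F, y smooth on the base, are horizontal and
   span H. *)
Require Import Defs.
From HB Require Import structures.
From mathcomp Require Import all_boot all_order all_algebra.
From mathcomp Require Import all_classical all_reals all_analysis.
From mathcomp Require Import ring lra.
Set Implicit Arguments.
Unset Strict Implicit.
Unset Printing Implicit Defensive.
Import Order.TTheory GRing.Theory Num.Theory.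
Import numFieldNormedType.Exports.
Local Open Scope classical_set_scope.
Local Open Scope ring_scope.

(** * Smooth functions of several variables *)

(** Fields, derivations and the connection are global objects: a tangent vector acts on globally
    smooth functions only, and [bracket] and [nabla] take fields defined on the whole manifold.
    Coordinates, frames and gradients are local, so each is multiplied by a plateau function before
    use; its characteristic identity then holds only near the chosen point, or with the plateau as a
    factor. A pointwise statement about [nabla] is reached by extending vectors to global horizontal
    sections and evaluating an identity of fields at the point.

    Smoothness means differentiability of all iterated partial derivatives. It is proved by
    exhibiting a class of functions that contains its own partial derivatives. The same device
    serves algebraic combinations and compositions, the flat function behind the bumps, and the
    parametric integrals behind Hadamard's lemma.

    Integrability is a by-product of the geodesic property, as torsion-freeness expresses the
    bracket by two covariant derivatives. *)

Lemma differentiable_linear_approx (R : realType) (V : normedModType R) (f : V -> R)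
    (L : {linear V -> R}) x : continuous L ->
  (forall e, 0 < e -> \forall h \near 0, `|f (h + x) - f x - L h| <= e * `|h|) ->
  differentiable f x /\ 'd f x = L :> (V -> R).
Proof.
move=> cL fL.
have E : f \o shift x = cst (f x) + L +o_ 0 id.
  apply/eqaddoP => e e0; near=> h.
  rewrite [X in `|X|](_ : _ = f (h + x) - f x - L h); last first.
    by rewrite !fctE /= -addrA -opprD.
  by near: h; exact: fL.
have dL := diff_unique cL E.
by split => //; apply/diff_locallyP; rewrite dL.
Unshelve. all: by end_near. Qed.

Lemma diff_approx (R : realType) (V : normedModType R) (f : V -> R) x :
  differentiable f x ->
  forall e, 0 < e -> \forall h \near 0, `|f (h + x) - f x - 'd f x h| <= e * `|h|.
Proof.
move=> /diff_locally /eqaddoP H e e0.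
have := H e e0; apply: filterS => h /=.
rewrite [X in `|X|](_ : _ = f (h + x) - f x - 'd f x h) //.
by rewrite !fctE /= -addrA -opprD.
Qed.

Lemma near_eq_differentiable (R : realType) (V : normedModType R) (f g : V -> R) x :
  (\near x, f x = g x) -> differentiable f x -> differentiable g x.
Proof.
move=> fg df; apply: (@differentiable_linear_approx _ _ _ ('d f x) _ _ _).1.
  exact: diff_continuous.
move=> e e0; have fgx : f x = g x := nbhs_singleton fg.
move: fg; rewrite (near_shift 0 x) => fg.
move: fg (diff_approx df e0); apply: filterS2 => h /=.
by rewrite subr0 fgx => -> +.
Qed.

Section SmoothAt.
Context {R : realType}.

(* The neighborhood may depend on the order of derivation. *)
Definition smooth_at n (f : 'rV[R]_n -> R) (x : 'rV[R]_n) : Prop :=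
  forall s, \forall y \near x, differentiable (iter_partial s f) y.

Lemma smooth_onP n (f : 'rV[R]_n -> R) (U : set 'rV[R]_n) : open U ->
  smooth_on U f <-> forall x, U x -> smooth_at f x.
Proof.
move=> oU; split=> [fU x Ux s|fU s x Ux].
  by near=> y; apply: fU; near: y; exact: open_nbhs_nbhs.
by have := fU _ Ux s => /nbhs_singleton.
Unshelve. all: by end_near. Qed.

Lemma smooth_at_diff n (f : 'rV[R]_n -> R) x : smooth_at f x ->
  \forall y \near x, differentiable f y.
Proof. by move=> /(_ [::]). Qed.

Lemma smooth_at_continuous n (f : 'rV[R]_n -> R) x : smooth_at f x ->
  {for x, continuous f}.
Proof.
move=> /smooth_at_diff dx; apply: differentiable_continuous.
exact: (nbhs_singleton dx).
Qed.

Lemma smooth_at_partial n (f : 'rV[R]_n -> R) x i : smooth_at f x ->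
  smooth_at ('D_(delta_mx 0 i) f) x.
Proof. by move=> fx s; have := fx (rcons s i); rewrite /iter_partial foldr_rcons. Qed.

(* Smoothness by coinduction: a class of functions that is stable under partial
   derivatives near [x] consists of functions smooth at [x]. *)
Lemma smooth_at_coind n (P : ('rV[R]_n -> R) -> Prop) x :
  (forall f, P f -> (\forall y \near x, differentiable f y) /\
    forall i, exists2 g, P g & \forall y \near x, 'D_(delta_mx 0 i) f y = g y) ->
  forall f, P f -> smooth_at f x.
Proof.
move=> HP f Pf s.
have [g Pg] : exists2 g, P g & \forall y \near x, iter_partial s f y = g y.
  elim: s => [|i s [g Pg fg]]; first by exists f => //; near=> y.
  have [_ /(_ i)[h Ph gh]] := HP _ Pg; exists h => //.
  (* A derivative at [y] sees a whole neighbourhood of [y], so [y] is taken in the interior of the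
     set where the two functions agree. *)
  move: fg => /nbhs_interior fg; near=> y; rewrite -(near gh y)//=.
  by apply: near_eq_derive; near: y.
move=> /nbhs_interior fg; have [dg _] := HP _ Pg.
near=> y; apply: (@near_eq_differentiable _ _ g).
  have : ((fun y => iter_partial s f y = g y)^°) y by near: y.
  by apply: filterS => z ->.
by near: y.
Unshelve. all: by end_near. Qed.

Lemma deriv_coords n (f : 'rV[R]_n -> R) x v : differentiable f x ->
  'd f x v = \sum_j v 0 j * 'D_(delta_mx 0 j) f x.
Proof.
move=> df; rewrite {1}(row_sum_delta v) linear_sum.
by apply: eq_bigr => j _; rewrite linearZ deriveE.
Qed.

Lemma row_diff m n (h : 'I_m -> 'rV[R]_n -> R) x :
  (forall j, differentiable (h j) x) ->
  differentiable (fun y => \row_j h j y) x.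
Proof.
move=> dh; rewrite [X in differentiable X _](_ : _ =
    \sum_j (fun y => h j y *: (delta_mx 0 j : 'rV[R]_m))); last first.
  apply/funext => y; rewrite fct_sumE [LHS]row_sum_delta.
  by apply: eq_bigr => j _; rewrite mxE.
by apply: differentiable_sum => j; exact: differentiableZl.
Qed.

Lemma chain_partial m n (g : 'rV[R]_m -> R) (h : 'I_m -> 'rV[R]_n -> R) x i :
  differentiable g (\row_j h j x) -> (forall j, differentiable (h j) x) ->
  'D_(delta_mx 0 i) (fun y => g (\row_j h j y)) x =
  \sum_j 'D_(delta_mx 0 j) g (\row_j h j x) * 'D_(delta_mx 0 i) (h j) x.
Proof.
move=> dg dh; have dH := row_diff dh.
have dgH : differentiable (g \o (fun y => \row_j h j y)) x.
  exact: differentiable_comp.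
rewrite deriveE //= (diff_comp dH dg) /= deriv_coords //.
apply: eq_bigr => j _; rewrite mulrC; congr (_ * _).
rewrite -deriveE // derive_mx ?mxE; last exact: diff_derivable.
by under eq_fun do rewrite mxE.
Qed.

(** Closed under partial derivatives near [x] by design: each rule of differentiation leads from the
    constructors back to them. [SmoothComp1] therefore carries a whole tower [b], each function the
    derivative of its predecessor, since the chain rule turns [b k] into [b k.+1]. *)
Inductive smooth_gen n (x : 'rV[R]_n) : ('rV[R]_n -> R) -> Prop :=
| SmoothBase f of smooth_at f x : smooth_gen x f
| SmoothCst (c : R) : smooth_gen x (fun _ => c)
| SmoothCoord j : smooth_gen x (fun y => y 0 j)
| SmoothAdd f g of smooth_gen x f & smooth_gen x g :
    smooth_gen x (fun y => f y + g y)
| SmoothMul f g of smooth_gen x f & smooth_gen x g :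
    smooth_gen x (fun y => f y * g y)
| SmoothInv f of f x != 0 & smooth_gen x f : smooth_gen x (fun y => (f y)^-1)
| SmoothComp1 (b : nat -> R -> R) k f of
    (forall l t, is_derive t (1 : R) (b l) (b l.+1 t)) & smooth_gen x f :
    smooth_gen x (fun y => b k (f y))
| SmoothComp m (g : 'rV[R]_m -> R) (h : 'I_m -> 'rV[R]_n -> R) of
    smooth_at g (\row_j h j x) & (forall j, smooth_gen x (h j)) :
    smooth_gen x (fun y => g (\row_j h j y)).

Lemma smooth_gen_sum n (x : 'rV[R]_n) (I : Type) (r : seq I) (P : pred I)
    (F : I -> 'rV[R]_n -> R) :
  (forall i, smooth_gen x (F i)) -> smooth_gen x (fun y => \sum_(i <- r | P i) F i y).
Proof.
move=> HF; elim: r => [|i r IH].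
  rewrite [X in smooth_gen _ X](_ : _ = fun=> 0); first exact: SmoothCst.
  by apply/funext => y; rewrite big_nil.
case: (boolP (P i)) => Pi.
  rewrite [X in smooth_gen _ X](_ : _ = fun y => F i y + \sum_(i <- r | P i) F i y).
    exact: SmoothAdd.
  by apply/funext => y; rewrite big_cons Pi.
by under eq_fun do rewrite big_cons (negPf Pi).
Qed.

Lemma smooth_gen_step n (x : 'rV[R]_n) f : smooth_gen x f ->
  (\forall y \near x, differentiable f y) /\
    forall i, exists2 g, smooth_gen x g &
      \forall y \near x, 'D_(delta_mx 0 i) f y = g y.
Proof.
have gdiff (f0 : 'rV[R]_n -> R) : (\forall y \near x, differentiable f0 y) ->
    {for x, continuous f0}.
  by move=> /nbhs_singleton; exact: differentiable_continuous.
elim=> {f} [f fx|c|j|f g Gf [df Df] Gg [dg Dg]|f g Gf [df Df] Gg [dg Dg]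
           |f fx0 Gf [df Df]|b k f db Gf [df Df]|m g h gx Gh IH].
- split=> [|i]; first exact: smooth_at_diff.
  by exists ('D_(delta_mx 0 i) f); [apply/SmoothBase/smooth_at_partial|near=> y].
- split=> [|i]; first by near=> y; exact: differentiable_cst.
  by exists (fun=> 0); [exact: SmoothCst|near=> y; exact: derive_cst].
- split=> [|i]; first by near=> y; exact: differentiable_coord.
  exists (fun=> (delta_mx 0 i : 'rV[R]_n) 0 j); first exact: SmoothCst.
  near=> y; have := @derive_id R 'rV[R]_n y (delta_mx 0 i).
  rewrite derive_mx; last exact: derivable_id.
  by move=> /matrixP /(_ 0 j); rewrite mxE => <-.
- split=> [|i]; first by near=> y; apply: differentiableD; near: y.
  have [f' Gf' ff'] := Df i; have [g' Gg' gg'] := Dg i.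
  exists (fun y => f' y + g' y); first exact: SmoothAdd.
  near=> y; rewrite -(near ff' y)// -(near gg' y)//.
  by rewrite (@deriveD _ _ _ f g) //; apply: diff_derivable; near: y.
- split=> [|i]; first by near=> y; apply: differentiableM; near: y.
  have [f' Gf' ff'] := Df i; have [g' Gg' gg'] := Dg i.
  exists (fun y => f y * g' y + g y * f' y).
    by apply: SmoothAdd; exact: SmoothMul.
  near=> y; rewrite -(near ff' y)// -(near gg' y)//.
  by rewrite (@deriveM _ _ f g) //; apply: diff_derivable; near: y.
- have f0 : \forall y \near x, f y != 0 by exact: (cvgr_neq0 (f x) (gdiff _ df)).
  split=> [|i]; first by near=> y; apply: differentiableV; near: y.
  have [f' Gf' ff'] := Df i.
  exists (fun y => -1 * ((f y)^-1 * (f y)^-1) * f' y).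
    apply: SmoothMul => //; apply: SmoothMul; first exact: SmoothCst.
    by apply: SmoothMul; exact: SmoothInv.
  near=> y; rewrite -(near ff' y)//.
  rewrite (@deriveV _ _ f).
  + by rewrite mulN1r -invfM -expr2.
  + by near: y.
  + by apply: diff_derivable; near: y.
- have dbl l t : differentiable (b l) t by apply/derivable1_diffP; have [] := db l t.
  split=> [|i].
    near=> y; apply: (@differentiable_comp _ _ _ _ f (b k)) => //; near: y; exact: df.
  have [f' Gf' ff'] := Df i.
  exists (fun y => b k.+1 (f y) * f' y).
    by apply: SmoothMul => //; exact: SmoothComp1.
  near=> y; rewrite -(near ff' y)//.
  have dfy : differentiable f y by near: y.
  rewrite deriveE; last exact: (@differentiable_comp _ _ _ _ f (b k)).
  rewrite (@diff_comp _ _ _ _ f (b k)) //= deriveE //.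
  have [db1 db2] := db k (f y).
  by rewrite (deriv1E db1) derive1E db2 [LHS]mulrC.
- have dh : \forall y \near x, forall j, differentiable (h j) y.
    have := @filter_forall _ _ (fun j y => differentiable (h j) y) (nbhs x) _.
    by apply=> j; have [] := IH j.
  have dH : \forall y \near x, differentiable (fun y => \row_j h j y) y.
    by near=> y; apply: row_diff; near: y.
  have cH : {for x, continuous (fun y => \row_j h j y)}.
    by apply: differentiable_continuous; exact: (nbhs_singleton dH).
  have dg : \forall y \near x, differentiable g (\row_j h j y).
    by have /cH := smooth_at_diff gx.
  split=> [|i].
    near=> y; apply: (@differentiable_comp _ _ _ _ (fun y => \row_j h j y) g);
      by near: y.
  have /choice[h' Hh'] j : exists h', smooth_gen x h' /\
      \forall y \near x, 'D_(delta_mx 0 i) (h j) y = h' y.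
    by have [_ /(_ i)[h' ? ?]] := IH j; exists h'.
  exists (fun y => \sum_j 'D_(delta_mx 0 j) g (\row_j h j y) * h' j y).
    apply: (@smooth_gen_sum _ x _ _ xpredT
      (fun j y => 'D_(delta_mx 0 j) g (\row_j h j y) * h' j y)) => j.
    apply: SmoothMul; last exact: (Hh' j).1.
    by apply: (@SmoothComp _ x m ('D_(delta_mx 0 j) g) h) => //; exact: smooth_at_partial.
  have hh' : \forall y \near x, forall j, 'D_(delta_mx 0 i) (h j) y = h' j y.
    have := @filter_forall _ _ (fun j y => 'D_(delta_mx 0 i) (h j) y = h' j y) (nbhs x) _.
    by apply=> j; exact: (Hh' j).2.
  near=> y; rewrite chain_partial; last 2 first.
  + by near: y.
  + by near: y.
  by apply: eq_bigr => j _; congr (_ * _); apply: (near hh' y).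
Unshelve. all: by end_near. Qed.

Lemma smooth_genP n (x : 'rV[R]_n) f : smooth_gen x f -> smooth_at f x.
Proof. by apply: smooth_at_coind => {}f; exact: smooth_gen_step. Qed.

(** Coinduction on the class of functions that agree near [x] with some function smooth at [x]. *)
Lemma near_eq_smooth_at n (f g : 'rV[R]_n -> R) x :
  (\forall y \near x, f y = g y) -> smooth_at f x -> smooth_at g x.
Proof.
move=> fg fx; apply: (@smooth_at_coind _ (fun g => exists2 f, smooth_at f x &
  \forall y \near x, f y = g y)); last by exists f.
move=> {f fx fg}g [f fx fg]; have /nbhs_interior fg' := fg; split.
  near=> y; apply: (@near_eq_differentiable _ _ f); first by near: y.
  by near: y; exact: smooth_at_diff.
move=> i; exists ('D_(delta_mx 0 i) f).
  by exists ('D_(delta_mx 0 i) f); [exact: smooth_at_partial|near=> y].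
near=> y; apply: near_eq_derive.
have : ((fun y => f y = g y)^°) y by near: y.
by apply: filterS => z ->.
Unshelve. all: by end_near. Qed.

End SmoothAt.

(** * Bump functions *)

Section Bump.
Context {R : realType}.
Implicit Types (p : {poly R}) (t : R).

(** The flat function exp(-1/t), with a polynomial factor in 1/t that makes the family closed under
    derivation: for t > 0, differentiating p(1/t) exp(-1/t) replaces p by (p - p') X^2. *)
Definition exp_flat p t : R := if 0 < t then p.[t^-1] * expR (- t^-1) else 0.

(** Coefficient by coefficient, from s^i <= i! exp(s), a single term of the exponential series. *)
Lemma horner_expR_bound p :
  exists2 C, 0 <= C & forall s, 0 <= s -> `|p.[s]| <= C * expR s.
Proof.
exists (\sum_(i < size p) `|p`_i| * i`!%:R).
  by apply: sumr_ge0 => i _; rewrite mulr_ge0.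
move=> s s0; rewrite horner_coef (le_trans (ler_norm_sum _ _ _)) // mulr_suml.
apply: ler_sum => i _; rewrite normrM -mulrA ler_wpM2l //.
rewrite ger0_norm ?exprn_ge0 // mulrC -ler_pdivrMr ?ltr0n ?fact_gt0 //.
case: (nat_of_ord i) => [|k].
  by rewrite expr0 fact0 invr1 mulr1 -expR0 ler_expR.
by apply: le_trans (expR_ge1Dxn k s0); rewrite lerDr.
Qed.

(** The previous bound for p X^2 at s = 1/t; the extra X^2 yields the factor t^2. Quadratic decay
    gives derivative 0 at the origin, where the formula for t > 0 is of no help. *)
Lemma exp_flat_small p : exists2 C, 0 <= C & forall t, `|exp_flat p t| <= C * t ^+ 2.
Proof.
have [C C0 HC] := horner_expR_bound (p * 'X^2); exists C => // t.
rewrite /exp_flat; case: ifPn => t0; last by rewrite normr0 mulr_ge0 ?sqr_ge0.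
have ti0 : 0 <= t^-1 by rewrite invr_ge0 ltW.
have := HC _ ti0; rewrite hornerM hornerXn normrM.
rewrite (ger0_norm (exprn_ge0 2 ti0)) exprVn ler_pdivrMr ?exprn_gt0 // => H.
rewrite normrM (ger0_norm (expR_ge0 _)) expRN ler_pdivrMr ?expR_gt0 //.
by rewrite mulrAC.
Qed.

Lemma is_derive_exp_flat p t :
  is_derive t (1 : R) (exp_flat p) (exp_flat ((p - p^`()) * 'X^2) t).
Proof.
have [t0|t0|->] := ltrgtP t 0.
- have -> : exp_flat ((p - p^`()) * 'X^2) t = 0 by rewrite /exp_flat ltNge (ltW t0).
  apply: (@near_eq_is_derive _ _ _ (cst (0 : R))).
  near=> s; rewrite /exp_flat ltNge.
  have -> //: s <= 0 by near: s; apply: filterS (lt_nbhsl t0) => ? /ltW.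
- have dV : is_derive t (1 : R) (fun s : R => s^-1) (- t ^- 2 *: 1).
    by apply: is_deriveV; rewrite gt_eqF.
  have dN : is_derive t (1 : R) (fun s : R => - s^-1) (- (- t ^- 2 *: 1)).
    exact: (@is_deriveN _ _ _ (fun s : R => s^-1)).
  have dE : is_derive t (1 : R) (fun s : R => expR (- s^-1))
      (expR (- t^-1) * (- (- t ^- 2 *: 1))).
    exact: (@is_derive1_comp _ expR (fun s : R => - s^-1)).
  have dP : is_derive t (1 : R) (fun s : R => p.[s^-1])
      (p^`().[t^-1] * (- t ^- 2 *: 1)).
    exact: (@is_derive1_comp _ (horner p) (fun s : R => s^-1)).
  have dM : is_derive t (1 : R) (fun s : R => p.[s^-1] * expR (- s^-1))
      (exp_flat ((p - p^`()) * 'X^2) t).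
    have dPE := is_deriveM dP dE; refine (is_derive_eq dPE _).
    rewrite /exp_flat t0 /GRing.scale /= !hornerE /= ?opprK; field; rewrite gt_eqF //.
  apply: near_eq_is_derive dM.
  by near=> s; rewrite /exp_flat ifT //; near: s; exact: lt_nbhsr.
- have [C C0 HC] := exp_flat_small p.
  have E0 q : exp_flat q 0 = 0 by rewrite /exp_flat ltxx.
  rewrite E0.
  have cv : (fun h => h^-1 *: (exp_flat p (h *: 1 + 0) - exp_flat p 0)) @ (0 : R)^' --> (0 : R).
    apply/cvgrPdist_le => e e0; near=> h.
    have h0 : h != 0 by near: h; exact: nbhs_dnbhs_neq.
    rewrite E0 sub0r subr0 addr0 normrN normrZ [_ *: 1]mulr1.
    rewrite normfV ler_pdivrMl ?normr_gt0 //.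
    apply: le_trans (HC h) _; rewrite -[h ^+ 2]real_normK ?num_real //.
    rewrite expr2 mulrA mulrC ler_wpM2l //.
    (* [C] may vanish, hence the division by [C + 1]. *)
    have : `|h| <= e / (C + 1).
      near: h; apply: dnbhs0_le; rewrite divr_gt0 //; lra.
    rewrite ler_pdivlMr; last lra.
    have := normr_ge0 h; nra.
  apply: DeriveDef; first by apply/cvg_ex; exists 0.
  exact: cvg_lim cv.
Unshelve. all: by end_near. Qed.

(** The polynomial factor of the [l]-th derivative of exp(-1/t), so that
    [exp_flat (exp_flat_iter l)] is the tower asked for by [SmoothComp1]. *)
Definition exp_flat_iter l : {poly R} := iter l (fun p => (p - p^`()) * 'X^2) 1.

Definition bump t : R := exp_flat 1 t.

Lemma bump_gt0 t : 0 < t -> 0 < bump t.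
Proof. by move=> t0; rewrite /bump /exp_flat t0 hornerC mul1r expR_gt0. Qed.

Lemma bump_eq0 t : t <= 0 -> bump t = 0.
Proof. by move=> t0; rewrite /bump /exp_flat ltNge t0. Qed.

Lemma bump_ge0 t : 0 <= bump t.
Proof. by have [/bump_eq0->//|/bump_gt0/ltW] := leP t 0. Qed.

Lemma smooth_gen_bump n (x : 'rV[R]_n) f :
  smooth_gen x f -> smooth_gen x (fun y => bump (f y)).
Proof.
move=> fx; apply: (@SmoothComp1 _ _ x (fun l => exp_flat (exp_flat_iter l)) 0 f) => //.
by move=> l t; exact: is_derive_exp_flat.
Qed.

Lemma coord_norm_le n (x : 'rV[R]_n) i : `|x 0 i| <= `|x|.
Proof.
by rewrite [leRHS]/Num.norm /= mx_normrE; apply/bigmax_geP; right => /=; exists (0, i).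
Qed.

Lemma norm_lt_coord n (x : 'rV[R]_n) r : 0 < r -> (forall i, `|x 0 i| < r) -> `|x| < r.
Proof.
move=> r0 H; rewrite [ltLHS]/Num.norm /= mx_normrE; apply/bigmax_ltP; split => //=.
by case=> i j _ /=; rewrite (ord1 i).
Qed.

(** The quotient bump(a) / (bump(a) + bump(b)) with a = e^2 - q and b = q - e^2/2, where q is the
    squared Euclidean distance to [p]; the norm of the library is the maximum norm, which is not
    smooth. The denominator is positive because a + b > 0. Where q <= e^2/2 the quotient is 1, and
    where some coordinate differs by at least e it is 0. *)
Lemma plateau_rV n (p : 'rV[R]_n) e : 0 < e ->
  exists rho : 'rV[R]_n -> R, [/\ forall x, smooth_at rho x,
    \forall x \near p, rho x = 1 & forall x, e <= `|x - p| -> rho x = 0].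
Proof.
move=> e0; pose q (x : 'rV[R]_n) : R := \sum_j (x 0 j - p 0 j) * (x 0 j - p 0 j).
have sq x : smooth_gen x q.
  apply: (@smooth_gen_sum _ _ x _ _ xpredT
    (fun j (x : 'rV[R]_n) => (x 0 j - p 0 j) * (x 0 j - p 0 j))) => j.
  by apply: SmoothMul; apply: SmoothAdd; [exact: SmoothCoord|exact: SmoothCst|
     exact: SmoothCoord|exact: SmoothCst].
pose a x := e ^+ 2 + (-1) * q x; pose b x := q x + (- (e ^+ 2 / 2)).
have sa x : smooth_gen x a.
  by apply: SmoothAdd; [exact: SmoothCst|apply: SmoothMul => //; exact: SmoothCst].
have sb x : smooth_gen x b by apply: SmoothAdd => //; exact: SmoothCst.
have e2 : 0 < e ^+ 2 by rewrite exprn_gt0.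
have ab x : 0 < bump (a x) + bump (b x).
  have [a0|a0] := ltP 0 (a x); first by rewrite ltr_pwDl ?bump_gt0 ?bump_ge0.
  rewrite ltr_wpDl ?bump_ge0 ?bump_gt0 //; move: a0; rewrite /a /b; lra.
exists (fun x => bump (a x) * (bump (a x) + bump (b x))^-1); split=> [x| |x ex].
- apply: smooth_genP; apply: SmoothMul; first exact: (smooth_gen_bump (sa x)).
  apply: SmoothInv; first by rewrite gt_eqF.
  by apply: SmoothAdd; [exact: (smooth_gen_bump (sa x))|exact: (smooth_gen_bump (sb x))].
- have cq : {for p, continuous q}.
    exact: (smooth_at_continuous (smooth_genP (sq p))).
  have qp : q p = 0 by rewrite /q big1 // => j _; rewrite subrr mul0r.
  near=> x.
  have bx : bump (b x) = 0.
    apply: bump_eq0; rewrite /b subr_le0; apply: ltW; near: x.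
    by apply: (cvgr_lt (q p)) => //; rewrite qp divr_gt0.
  by have := ab x; rewrite bx addr0 => h; rewrite mulfV // gt_eqF.
- rewrite bump_eq0 ?mul0r // /a mulN1r subr_le0 leNgt; apply/negP => qe.
  move: ex; rewrite leNgt => /negP; apply; apply: norm_lt_coord => // i.
  have qi : (x 0 i - p 0 i) * (x 0 i - p 0 i) < e ^+ 2.
    apply: le_lt_trans qe; rewrite /q (bigD1 i) //= lerDl.
    by apply: sumr_ge0 => j _; rewrite -expr2 sqr_ge0.
  by rewrite !mxE ltr_norml; apply/andP; split; nra.
Unshelve. all: by end_near. Qed.

End Bump.

(** * Hadamard's lemma *)

Section Hadamard.
Context {R : realType}.
Local Notation mu := (@lebesgue_measure R).
Local Notation I01 := `[0%R, 1%R]%classic.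

Lemma is_derive_line n (f : 'rV[R]_n -> R) (v a : 'rV[R]_n) (t : R) :
  differentiable f (t *: v + a) ->
  is_derive t (1 : R) (fun s : R => f (s *: v + a))
    (\sum_j v 0 j * 'D_(delta_mx 0 j) f (t *: v + a)).
Proof.
move=> df; have dl := is_diffD (is_diff_scalel t v) (is_diff_cst a t).
have dl1 : differentiable (fun s : R => s *: v + a) t.
  exact: (@ex_diff _ _ _ _ _ _ _ dl).
have dc : differentiable (fun s : R => f (s *: v + a)) t.
  exact: (differentiable_comp dl1 df).
apply: DeriveDef; first by apply/derivable1_diffP; exact: dc.
rewrite deriveE // (diff_comp dl1 df) /= -deriv_coords //.
by congr ('d f _ _); rewrite (@diff_val _ _ _ _ _ _ _ dl) fctE /= addr0 scale1r.
Qed.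

(** Strict differentiability: the mean value theorem on the segment from [y] to [h + y], together
    with continuity of the partial derivatives at [c]. The uniformity in [y] is what differentiation
    under the integral sign requires. *)
Lemma smooth_at_strict n (f : 'rV[R]_n -> R) c e : smooth_at f c -> 0 < e ->
  exists2 d, 0 < d & forall y h, `|y - c| < d -> `|h| < d ->
    `|f (h + y) - f y - \sum_j h 0 j * 'D_(delta_mx 0 j) f y| <= e * `|h|.
Proof.
(* Every partial derivative is compared with its value at [c] twice, at [y] and at the intermediate
   point, whence the 2; [n.+1] keeps [e1] positive when [n] is 0. *)
move=> fc e0; pose e1 := e / (2 * n.+1%:R).
have e10 : 0 < e1 by rewrite divr_gt0 // mulr_gt0.
have H1 : \forall y \near c, forall j,
    `|'D_(delta_mx 0 j) f c - 'D_(delta_mx 0 j) f y| < e1.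
  have := @filter_forall _ _ (fun j y =>
    `|'D_(delta_mx 0 j) f c - 'D_(delta_mx 0 j) f y| < e1) (nbhs c) _.
  apply=> j; have := smooth_at_continuous (smooth_at_partial j fc).
  by move=> /cvgrPdist_lt /(_ _ e10).
have H2 := smooth_at_diff fc.
have : \forall y \near c, differentiable f y /\ forall j,
    `|'D_(delta_mx 0 j) f c - 'D_(delta_mx 0 j) f y| < e1.
  by near=> y; split; near: y.
move=> /nbhs_ballP [d /= d0 Hd]; exists (d / 2); first by rewrite divr_gt0.
move=> y h yd hd.
have inb (s : R) : 0 <= s <= 1 -> ball c d (s *: h + y).
  move=> /andP[s0 s1]; rewrite -ball_normE /= distrC -addrA.
  apply: le_lt_trans (ler_normD _ _) _; rewrite [ltRHS](splitr d) ltr_leD ?ltW //.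
  rewrite normrZ ger0_norm //; apply: le_lt_trans hd.
  by rewrite ler_piMl.
have dphi (s : R) : 0 <= s <= 1 -> is_derive s (1 : R) (fun s : R => f (s *: h + y))
    (\sum_j h 0 j * 'D_(delta_mx 0 j) f (s *: h + y)).
  by move=> /inb /Hd [df _]; exact: is_derive_line.
have s01 (s : R) : s \in `[0%R, 1%R]%R -> 0 <= s <= 1 by rewrite in_itv.
have [] := @MVT_segment _ (fun s : R => f (s *: h + y))
  (fun s => \sum_j h 0 j * 'D_(delta_mx 0 j) f (s *: h + y)) 0 1 ler01.
- by move=> s /subset_itv_oo_cc /s01 /dphi.
- by apply: derivable_within_continuous => s /s01 /dphi [].
move=> s /s01 ss; rewrite scale1r scale0r add0r subr0 mulr1 => ->.
rewrite -sumrB; apply: le_trans (ler_norm_sum _ _ _) _.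
have /Hd[_ Ds] := inb _ ss.
have /Hd[_] : ball c d y.
  by have := inb 0; rewrite scale0r add0r lexx ler01; apply.
move=> Dy; apply: (@le_trans _ _ (\sum_(j < n) `|h| * (2 * e1))).
  apply: ler_sum => j _; rewrite -mulrBr normrM ler_pM ?coord_norm_le //.
  have := Ds j; have := Dy j.
  set u := 'D__ _ _; set v := 'D__ _ _; set w := 'D__ _ _.
  rewrite !ltr_norml ler_norml => /andP[? ?] /andP[? ?]; apply/andP; split; lra.
have e1n : 2 * e1 * n%:R <= e.
  have -> : 2 * e1 * n%:R = e * (n%:R / n.+1%:R) by rewrite /e1; field; rewrite addrC natr1.
  by rewrite ler_piMr ?(ltW e0) // ler_pdivrMr // mul1r ler_nat.
by rewrite sumr_const card_ord -[leLHS]mulr_natr -mulrA [leRHS]mulrC ler_wpM2l.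
Unshelve. all: by end_near. Qed.

Lemma ray_in_ball n (a x : 'rV[R]_n) (t : R) r : 0 <= t <= 1 -> `|x - a| < r ->
  `|t *: (x - a) + a - a| < r.
Proof.
move=> /andP[t0 t1]; apply: le_lt_trans.
by rewrite addrK normrZ ger0_norm // ler_piMl.
Qed.

Lemma ray_continuous n (a x : 'rV[R]_n) (t : R) :
  {for t, continuous (fun s : R => s *: (x - a) + a)}.
Proof.
apply: differentiable_continuous.
have d1 := is_diffD (is_diff_scalel t (x - a)) (is_diff_cst a t).
exact: (@ex_diff _ _ _ _ _ _ _ d1).
Qed.

Lemma within01_continuous (g : R -> R) :
  (forall t, 0 <= t <= 1 -> {for t, continuous g}) -> {within I01, continuous g}.
Proof.
by move=> Hg; apply: continuous_in_subspaceT => t; rewrite inE /= in_itv => /Hg.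
Qed.

Lemma integrable01 (g : R -> R) :
  (forall t, 0 <= t <= 1 -> {for t, continuous g}) -> mu.-integrable I01 (EFin \o g).
Proof.
move=> Hg; apply: continuous_compact_integrable; first exact: segment_compact.
exact: within01_continuous.
Qed.

Lemma sum_continuous_at (T : topologicalType) (I : Type) (s : seq I) (g : I -> T -> R) t :
  (forall i, {for t, continuous (g i)}) ->
  {for t, continuous (fun u => \sum_(i <- s) g i u)}.
Proof.
move=> Hg; elim: s => [|i s IH].
  rewrite (_ : (fun u => _) = cst 0); first exact: cst_continuous.
  by apply/funext => u; rewrite big_nil.
rewrite (_ : (fun u => _) = fun u => g i u + \sum_(i <- s) g i u).
  by apply: cvgD; [exact: Hg|exact: IH].
by apply/funext => u; rewrite big_cons.
Qed.

Lemma mu01 : fine (mu I01) = 1.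
Proof. by rewrite lebesgue_measure_itv /= lte_fin ltr01 sube0. Qed.

Lemma Rintegral01_sum (I : Type) (s : seq I) (g : I -> R -> R) :
  (forall i t, 0 <= t <= 1 -> {for t, continuous (g i)}) ->
  \int[mu]_(t in I01) (\sum_(i <- s) g i t) = \sum_(i <- s) \int[mu]_(t in I01) g i t.
Proof.
move=> Hg; elim: s => [|i s IH].
  rewrite big_nil (_ : (fun t => _) = fun=> 0).
    by rewrite Rintegral_cst // mul0r.
  by apply/funext => t; rewrite big_nil.
rewrite big_cons -IH -RintegralD //; last 2 first.
- by apply: integrable01; exact: Hg.
- apply: integrable01 => t t01; by apply: sum_continuous_at => j; exact: Hg.
by congr Rintegral; apply/funext => t; rewrite big_cons.
Qed.

(* Differentiating in [x] raises the exponent of the weight [t ^+ m]. *)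
Definition ray_mean n m (a : 'rV[R]_n) (f : 'rV[R]_n -> R) (x : 'rV[R]_n) : R :=
  \int[mu]_(t in I01) (t ^+ m * f (t *: (x - a) + a)).

Lemma ray_weight_continuous n m (a x : 'rV[R]_n) (f : 'rV[R]_n -> R) (t : R) :
  smooth_at f (t *: (x - a) + a) ->
  {for t, continuous (fun t : R => t ^+ m * f (t *: (x - a) + a))}.
Proof.
move=> /smooth_at_continuous cf; apply: cvgM; first exact: exprn_continuous.
exact: (continuous_comp (@ray_continuous _ a x t)).
Qed.

Lemma differentiable_coords_approx n (f : 'rV[R]_n -> R) x (c : 'I_n -> R) :
  (forall e, 0 < e -> \forall h \near (0 : 'rV[R]_n),
    `|f (h + x) - f x - \sum_j h 0 j * c j| <= e * `|h|) ->
  differentiable f x /\ forall i, 'D_(delta_mx 0 i) f x = c i.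
Proof.
move=> H; pose L0 (h : 'rV[R]_n) : R := \sum_j h 0 j * c j.
have linL : linear L0.
  move=> k u v; rewrite /L0 scaler_sumr -big_split /=; apply: eq_bigr => j _.
  by rewrite !mxE mulrDl scalerAl.
pose LM := GRing.isLinear.Build _ _ _ _ _ linL.
pose L : {linear 'rV[R]_n -> R} := HB.pack L0 LM.
have cL : continuous L.
  move=> h; apply: (@smooth_at_continuous _ _ L0); apply: smooth_genP.
  apply: (@smooth_gen_sum _ _ h _ _ xpredT (fun j (h : 'rV[R]_n) => h 0 j * c j)) => j.
  by apply: SmoothMul; [exact: SmoothCoord|exact: SmoothCst].
have [df dE] := differentiable_linear_approx cL H; split=> // i.
rewrite deriveE // dE /= /L0 (bigD1 i) //= big1 ?addr0 => [|j ji].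
  by rewrite mxE !eqxx mul1r.
by rewrite mxE (negPf ji) andbF mul0r.
Qed.

Lemma near0_norm_lt n d : 0 < d -> \forall h \near (0 : 'rV[R]_n), `|h| < d.
Proof.
move=> d0; apply/nbhs_ballP; exists d => // h.
by rewrite -ball_normE /= sub0r normrN.
Qed.

Lemma near_norm_lt n (a x : 'rV[R]_n) r : `|x - a| < r ->
  \forall y \near x, `|y - a| < r.
Proof.
move=> xr; have r0 : 0 < r := le_lt_trans (normr_ge0 _) xr.
have : nbhs x (ball a r).
  apply: open_nbhs_nbhs; split; first exact: ball_open.
  by rewrite -ball_normE /= distrC.
by apply: filterS => y; rewrite -ball_normE /= distrC.
Qed.

(** Differentiation under the integral sign. Near each t0 in [0, 1] the strict estimate holds
    jointly for t near t0 and small h; compactness of [0, 1] then gives one neighbourhood of h = 0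
    valid for all t, and the estimate is integrated. The chain rule along t (x - a) + a produces the
    additional factor t. *)
Lemma ray_mean_derive n m (a x : 'rV[R]_n) (f : 'rV[R]_n -> R) r :
  (forall y, `|y - a| < r -> smooth_at f y) -> `|x - a| < r ->
  differentiable (ray_mean m a f) x /\
  forall i, 'D_(delta_mx 0 i) (ray_mean m a f) x = ray_mean m.+1 a ('D_(delta_mx 0 i) f) x.
Proof.
move=> fr xr; apply: differentiable_coords_approx => e e0.
have r0 : 0 < r := le_lt_trans (normr_ge0 _) xr.
have frt y (t : R) : `|y - a| < r -> 0 <= t <= 1 -> smooth_at f (t *: (y - a) + a).
  by move=> yr t01; apply: fr; exact: ray_in_ball.
have near_r : \forall h \near (0 : 'rV[R]_n), `|h + x - a| < r.
  have := near_norm_lt xr; rewrite (near_shift 0 x).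
  by apply: filterS => h /=; rewrite subr0.
pose P (h : 'rV[R]_n) (t : R) := `|f (t *: h + (t *: (x - a) + a)) - f (t *: (x - a) + a)
  - \sum_j (t *: h) 0 j * 'D_(delta_mx 0 j) f (t *: (x - a) + a)| <= e * `|t *: h|.
have cov : \forall h \near (0 : 'rV[R]_n), I01 `<=` P h.
  have /compact_near_coveringP/near_covering_withinP K01 := @segment_compact R 0 1.
  apply: (K01 _ (nbhs (0 : 'rV[R]_n)) P _) => t0; rewrite /= in_itv /= => t01.
  have [d d0 Hd] := smooth_at_strict (frt _ _ xr t01) e0.
  have ct : \forall t \near t0, `|t *: (x - a) + a - (t0 *: (x - a) + a)| < d.
    have := @ray_continuous _ a x t0.
    by move=> /cvgrPdist_lt /(_ _ d0); apply: filterS => t; rewrite distrC.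
  near=> t h; rewrite /= in_itv /= => /andP[t_0 t_1]; apply: Hd.
    by near: t.
  rewrite normrZ ger0_norm //; apply: (@le_lt_trans _ _ `|h|).
    by rewrite ler_piMl.
  by near: h; exact: near0_norm_lt.
near=> h; have xhr : `|h + x - a| < r by near: h.
have cov_h : I01 `<=` P h by near: h.
have c1 t : 0 <= t <= 1 -> {for t, continuous (fun t : R => t ^+ m * f (t *: (h + x - a) + a))}.
  by move=> t01; apply: (@ray_weight_continuous n m a (h + x) f); exact: frt.
have c2 t : 0 <= t <= 1 -> {for t, continuous (fun t : R => t ^+ m * f (t *: (x - a) + a))}.
  by move=> t01; apply: (@ray_weight_continuous n m a x f); exact: frt.
have c3 j t : 0 <= t <= 1 -> {for t, continuous (fun t : R =>
    t ^+ m.+1 * 'D_(delta_mx 0 j) f (t *: (x - a) + a))}.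
  move=> t01; apply: (@ray_weight_continuous n m.+1 a x ('D_(delta_mx 0 j) f)).
  by apply: smooth_at_partial; exact: frt.
have c3' j t : 0 <= t <= 1 -> {for t, continuous (fun t : R =>
    h 0 j * (t ^+ m.+1 * 'D_(delta_mx 0 j) f (t *: (x - a) + a)))}.
  by move=> t01; apply: cvgM; [exact: cvg_cst|exact: c3].
rewrite /ray_mean -RintegralB //; last 2 first.
- exact: (integrable01 c1).
- exact: (integrable01 c2).
rewrite (eq_bigr (fun j => \int[mu]_(t in I01) 
   (h 0 j * (t ^+ m.+1 * 'D_(delta_mx 0 j) f (t *: (x - a) + a))))); last first.
  by move=> j _; rewrite RintegralZl //; exact: (integrable01 (c3 j)).
rewrite -Rintegral01_sum // -RintegralB //; last 2 first.
- by apply: integrable01 => t t01; apply: cvgB; [exact: c1|exact: c2].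
- by apply: integrable01 => t t01; apply: sum_continuous_at => j; exact: c3'.
have cI : mu.-integrable I01 (EFin \o (fun t : R => t ^+ m * f (t *: (h + x - a) + a) -
    t ^+ m * f (t *: (x - a) + a) -
    \sum_j h 0 j * (t ^+ m.+1 * 'D_(delta_mx 0 j) f (t *: (x - a) + a)))).
  apply: integrable01 => t t01; apply: cvgB.
    by apply: cvgB; [exact: c1|exact: c2].
  by apply: sum_continuous_at => j; exact: c3'.
apply: le_trans (le_normr_Rintegral _ cI) _ => //.
apply: (@le_trans _ _ (\int[mu]_(t in I01) (e * `|h|))).
  apply: le_Rintegral => //.
  - exact: integrable_norm cI.
  - by apply: integrable01 => t _; exact: cvg_cst.
  move=> t tI; have := cov_h t tI; rewrite /P => Ht.
  move: tI; rewrite /= in_itv /= => /andP[t0 t1].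
  have E : t *: (h + x - a) + a = t *: h + (t *: (x - a) + a).
    by rewrite -addrA scalerDr addrA.
  have -> : t ^+ m * f (t *: (h + x - a) + a) - t ^+ m * f (t *: (x - a) + a) -
     \sum_j h 0 j * (t ^+ m.+1 * 'D_(delta_mx 0 j) f (t *: (x - a) + a)) =
     t ^+ m * (f (t *: h + (t *: (x - a) + a)) - f (t *: (x - a) + a)
      - \sum_j (t *: h) 0 j * 'D_(delta_mx 0 j) f (t *: (x - a) + a)).
    rewrite -E !mulrBr mulr_sumr; congr (_ - _); apply: eq_bigr => j _.
    by rewrite mxE exprS; ring.
  rewrite normrM ger0_norm ?exprn_ge0 //.
  apply: le_trans (ler_piMl _ _) _ => //; first exact: exprn_ile1.
  apply: le_trans Ht _ => //.
  by rewrite ler_wpM2l ?(ltW e0) // normrZ ger0_norm // ler_piMl.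
rewrite Rintegral_cst // mu01 mulr1.
Unshelve. all: by end_near. Qed.

Lemma ray_mean_smooth n m (a x : 'rV[R]_n) (f : 'rV[R]_n -> R) r :
  (forall y, `|y - a| < r -> smooth_at f y) -> `|x - a| < r ->
  smooth_at (ray_mean m a f) x.
Proof.
move=> fr xr.
apply: (@smooth_at_coind _ _ (fun g => exists m (f : 'rV[R]_n -> R),
  (forall y, `|y - a| < r -> smooth_at f y) /\ g = ray_mean m a f)); last by exists m, f.
move=> _ {m f fr}[m [f [fr ->]]].
have near_r := near_norm_lt xr.
split=> [|i].
  by near=> y; apply: (ray_mean_derive m fr _).1; near: y.
exists (ray_mean m.+1 a ('D_(delta_mx 0 i) f)).
  by exists m.+1, ('D_(delta_mx 0 i) f); split=> // y /fr; exact: smooth_at_partial.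
by near=> y; apply: (ray_mean_derive m fr _).2; near: y.
Unshelve. all: by end_near. Qed.

(** The fundamental theorem of calculus along the segment from [a] to [x]; [g j] is the mean of the
    [j]-th partial derivative over that segment, with weight 1. Higher weights occur only in the
    derivatives of [g j]. *)
Lemma hadamard n (a : 'rV[R]_n) (f : 'rV[R]_n -> R) r :
  (forall y, `|y - a| < r -> smooth_at f y) ->
  exists g : 'I_n -> 'rV[R]_n -> R,
    (forall j x, `|x - a| < r -> smooth_at (g j) x) /\
    forall x, `|x - a| < r -> f x = f a + \sum_j (x 0 j - a 0 j) * g j x.
Proof.
move=> fr; exists (fun j => ray_mean 0 a ('D_(delta_mx 0 j) f)); split=> [j x xr|x xr].
  by apply: ray_mean_smooth xr => y /fr; exact: smooth_at_partial.
have frt (t : R) : 0 <= t <= 1 -> smooth_at f (t *: (x - a) + a).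
  by move=> t01; apply: fr; exact: ray_in_ball.
have dF (t : R) : 0 <= t <= 1 -> is_derive t (1 : R) (fun s : R => f (s *: (x - a) + a))
    (\sum_j (x - a) 0 j * 'D_(delta_mx 0 j) f (t *: (x - a) + a)).
  by move=> /frt /smooth_at_diff dt; apply: is_derive_line; exact: (nbhs_singleton dt).
have cj j (t : R) : 0 <= t <= 1 -> {for t, continuous (fun t : R =>
    t ^+ 0 * 'D_(delta_mx 0 j) f (t *: (x - a) + a))}.
  move=> t01; apply: (@ray_weight_continuous n 0 a x ('D_(delta_mx 0 j) f)).
  by apply: smooth_at_partial; exact: frt.
have cj' j (t : R) : 0 <= t <= 1 -> {for t, continuous (fun t : R =>
    (x - a) 0 j * (t ^+ 0 * 'D_(delta_mx 0 j) f (t *: (x - a) + a)))}.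
  by move=> t01; apply: cvgM; [exact: cvg_cst|exact: cj].
have FTC : \int[mu]_(t in I01) (\sum_j (x - a) 0 j *
      (t ^+ 0 * 'D_(delta_mx 0 j) f (t *: (x - a) + a))) = f x - f a.
  rewrite /Rintegral (@continuous_FTC2 _ _ (fun s : R => f (s *: (x - a) + a))) //.
  - by rewrite /= scale1r scale0r add0r subrK.
  - by apply: within01_continuous => t t01; apply: sum_continuous_at => j; exact: cj'.
  - have ct (t : R) : 0 <= t <= 1 -> {for t, continuous (fun s : R => f (s *: (x - a) + a))}.
      move=> t01; apply: (continuous_comp (@ray_continuous _ a x t)).
      exact: smooth_at_continuous (frt _ t01).
    split.
    + by move=> t; rewrite in_itv /= => /andP[/ltW t0 /ltW t1]; have [] := dF t _; rewrite ?t0.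
    + by apply: cvg_at_right_filter; apply: ct; rewrite lexx ler01.
    + by apply: cvg_at_left_filter; apply: ct; rewrite lexx ler01.
  - move=> t; rewrite in_itv /= => /andP[/ltW t0 /ltW t1].
    have t01 : 0 <= t <= 1 by rewrite t0.
    rewrite derive1E (@derive_val _ _ _ _ _ _ _ (dF t t01)).
    by apply: eq_bigr => j _; rewrite expr0 mul1r.
rewrite Rintegral01_sum // in FTC.
suff -> : \sum_j (x 0 j - a 0 j) * ray_mean 0 a ('D_(delta_mx 0 j) f) x = f x - f a.
  by rewrite addrC subrK.
rewrite -FTC; apply: eq_bigr => j _; rewrite RintegralZl //.
  by rewrite !mxE.
by apply: integrable01; exact: cj.
Qed.

End Hadamard.

(** * Smooth functions and tangent vectors on manifolds *)

Section LocalSmoothness.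
Context {R : realType} {n : nat} {M : smooth_manifold R n}.
Implicit Types (f g : M -> R) (p q : M) (c d : chart R n M).

Lemma cdom_near c p : cdom c p -> \forall q \near p, cdom c q.
Proof. by move=> cp; apply: open_nbhs_nbhs; split=> //; exact: cdom_open. Qed.

Lemma cimage_near c p : cdom c p -> \forall x \near cmap c p, (cmap c @` cdom c) x.
Proof.
by move=> cp; apply: open_nbhs_nbhs; split; [exact: cimage_open|exists p].
Qed.

Lemma cmap_near c p (P : set 'rV[R]_n) : cdom c p ->
  (\forall x \near cmap c p, P x) -> \forall q \near p, P (cmap c q).
Proof. by move=> cp; exact: (cmap_continuous cp). Qed.

Lemma cinv_near c p (P : set M) : cdom c p ->
  (\forall q \near p, P q) -> \forall x \near cmap c p, P (cinv c x).
Proof.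
move=> cp Pp; have cip : (cmap c @` cdom c) (cmap c p) by exists p.
by apply: (cinv_continuous cip); rewrite cmapK.
Qed.

Lemma cinvK_near c p : cdom c p ->
  \forall x \near cmap c p, cdom c (cinv c x) /\ cmap c (cinv c x) = x.
Proof.
by move=> /cimage_near; apply: filterS => _ [q cq <-]; rewrite cmapK.
Qed.

(** One chart suffices to establish smoothness at a point; [smooth_near_chart] then yields it in
    every chart of the atlas around that point. *)
Definition smooth_near p f : Prop :=
  exists c, [/\ atlas c, cdom c p & smooth_at (f \o cinv c) (cmap c p)].

Lemma smooth_on_at (U : set 'rV[R]_n) (f : 'rV[R]_n -> R) x :
  smooth_on U f -> nbhs x U -> smooth_at f x.
Proof. by move=> fU Ux s; apply: filterS Ux => y; exact: fU. Qed.

(** Near the image of [p], the expression of [f] in [c] is its expression in [d] composed with the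
    smooth transition map. The rows spell this map by coordinates, the form [SmoothComp] takes. *)
Lemma smooth_near_chart c p f : atlas c -> cdom c p -> smooth_near p f ->
  smooth_at (f \o cinv c) (cmap c p).
Proof.
move=> ac cp [d [ad dp fd]].
have h x : \row_j cmap d (cinv c x) 0 j = cmap d (cinv c x).
  by apply/rowP => j; rewrite mxE.
apply: (@near_eq_smooth_at _ _
    (fun x => (f \o cinv d) (\row_j cmap d (cinv c x) 0 j))).
  have := cinv_near cp (cdom_near dp).
  by apply: filterS => x dx; rewrite h /= cmapK.
apply: smooth_genP.
apply: (@SmoothComp _ _ _ _ (f \o cinv d) (fun j x => cmap d (cinv c x) 0 j)).
  by rewrite h cmapK.
move=> j; apply: SmoothBase; apply: (smooth_on_at (atlas_smooth j ac ad)).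
have := cinv_near cp (cdom_near dp); apply: filterS2 (cinvK_near cp) => x.
by move=> [cx cK] dx; exists (cinv c x).
Qed.

Lemma smooth_funP f : smooth_fun f <-> forall p, smooth_near p f.
Proof.
split=> [sf p|sf c ac].
  have [c ac cp] := atlas_cover p; exists c; split=> //.
  exact: (smooth_on_at (sf _ ac) (cimage_near cp)).
apply/smooth_onP; first exact: cimage_open.
by move=> _ [p cp <-]; exact: smooth_near_chart.
Qed.

Lemma near_eq_smooth_near p f g : (\forall q \near p, f q = g q) ->
  smooth_near p f -> smooth_near p g.
Proof.
move=> fg [c [ac cp fc]]; exists c; split=> //.
by apply: near_eq_smooth_at fc; exact: cinv_near fg.
Qed.

Lemma smooth_near_cst p (a : R) : smooth_near p (fun=> a).
Proof.
have [c ac cp] := atlas_cover p; exists c; split=> //.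
by apply: smooth_genP; exact: (SmoothCst _ a).
Qed.

Lemma smooth_nearD p f g : smooth_near p f -> smooth_near p g ->
  smooth_near p (fun q => f q + g q).
Proof.
move=> sf sg; have [c ac cp] := atlas_cover p; exists c; split=> //.
apply: smooth_genP; apply: (@SmoothAdd _ _ _ (f \o cinv c) (g \o cinv c));
  by apply: SmoothBase; exact: smooth_near_chart.
Qed.

Lemma smooth_nearM p f g : smooth_near p f -> smooth_near p g ->
  smooth_near p (fun q => f q * g q).
Proof.
move=> sf sg; have [c ac cp] := atlas_cover p; exists c; split=> //.
apply: smooth_genP; apply: (@SmoothMul _ _ _ (f \o cinv c) (g \o cinv c));
  by apply: SmoothBase; exact: smooth_near_chart.
Qed.

Lemma smooth_nearV p f : f p != 0 -> smooth_near p f ->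
  smooth_near p (fun q => (f q)^-1).
Proof.
move=> f0 sf; have [c ac cp] := atlas_cover p; exists c; split=> //.
apply: smooth_genP; apply: (@SmoothInv _ _ _ (f \o cinv c)).
  by rewrite /= cmapK.
by apply: SmoothBase; exact: smooth_near_chart.
Qed.

Lemma smooth_near_sum p (I : Type) (s : seq I) (P : pred I) (F : I -> M -> R) :
  (forall i, smooth_near p (F i)) -> smooth_near p (fun q => \sum_(i <- s | P i) F i q).
Proof.
move=> sF; elim: s => [|i s IH].
  by under eq_fun do rewrite big_nil; exact: smooth_near_cst.
under eq_fun do rewrite big_cons; case: (P i) => //.
exact: smooth_nearD.
Qed.

Lemma smooth_near_prod p (I : Type) (s : seq I) (P : pred I) (F : I -> M -> R) :
  (forall i, smooth_near p (F i)) -> smooth_near p (fun q => \prod_(i <- s | P i) F i q).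
Proof.
move=> sF; elim: s => [|i s IH].
  by under eq_fun do rewrite big_nil; exact: smooth_near_cst.
under eq_fun do rewrite big_cons; case: (P i) => //.
exact: smooth_nearM.
Qed.

Lemma smooth_fun_cst (a : R) : smooth_fun (fun _ : M => a).
Proof. by apply/smooth_funP => p; exact: smooth_near_cst. Qed.

Lemma smooth_funD f g : smooth_fun f -> smooth_fun g -> smooth_fun (fun q => f q + g q).
Proof.
by move=> /smooth_funP sf /smooth_funP sg; apply/smooth_funP => p; exact: smooth_nearD.
Qed.

Lemma smooth_funM f g : smooth_fun f -> smooth_fun g -> smooth_fun (fun q => f q * g q).
Proof.
by move=> /smooth_funP sf /smooth_funP sg; apply/smooth_funP => p; exact: smooth_nearM.
Qed.

Lemma smooth_fun_sum (I : Type) (s : seq I) (P : pred I) (F : I -> M -> R) :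
  (forall i, smooth_fun (F i)) -> smooth_fun (fun q => \sum_(i <- s | P i) F i q).
Proof.
move=> sF; apply/smooth_funP => p; apply: smooth_near_sum => i.
by have /smooth_funP := sF i.
Qed.

Lemma smooth_funN f : smooth_fun f -> smooth_fun (fun q => - f q).
Proof.
move=> sf; under eq_fun do rewrite -mulN1r.
exact: smooth_funM (smooth_fun_cst _) sf.
Qed.

Lemma smooth_funB f g : smooth_fun f -> smooth_fun g -> smooth_fun (fun q => f q - g q).
Proof. by move=> sf sg; exact: smooth_funD sf (smooth_funN sg). Qed.

(* The last clause says that the support of [rho] lies in the interior of [P]. *)
Lemma plateau p (P : set M) : (\forall q \near p, P q) ->
  exists rho : M -> R, [/\ smooth_fun rho, \forall q \near p, rho q = 1 &
    forall q, (\forall q' \near q, P q') \/ (\forall q' \near q, rho q' = 0)].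
Proof.
move=> /nbhs_interior Pp; have [c ac cp] := atlas_cover p.
pose a := cmap c p.
have : \forall x \near a, (cmap c @` cdom c) x /\ nbhs (cinv c x) P.
  have := cinv_near cp Pp; apply: filterS2 (cimage_near cp) => x cx Px.
  by split.
move=> /nbhs_ballP [e /= e0 He].
have in_ball x : `|x - a| <= e / 2 -> ball a e x.
  by rewrite -ball_normE /= distrC => /le_lt_trans; apply; lra.
have [r [sr r1 r0]] := plateau_rV a (divr_gt0 e0 (ltr0n _ 2)).
pose K0 := [set x : 'rV[R]_n | `|x - a| <= e / 2].
have cK0 : compact K0.
  apply: bounded_closed_compact.
    exists (`|a| + e / 2); split; first exact: num_real.
    move=> t at_ x /= xa; apply: ltW; apply: le_lt_trans at_.
    by rewrite -[x](subrK a) addrC (le_trans (ler_normD _ _)) // lerD2l.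
  rewrite (_ : K0 = closed_ball a (e / 2)); first exact: closed_ball_closed.
  rewrite closed_ballE ?divr_gt0 //; apply/funext => x /=.
  by rewrite /closed_ball_ /= distrC.
(* The Hausdorff property enters here: a compact image is closed, so its complement is an open set
   on which [rho] vanishes, and extension by 0 beyond the chart stays smooth. *)
have cK : closed (cinv c @` K0).
  apply: compact_closed; first exact: space_hausdorff.
  apply: continuous_compact => //; apply: continuous_in_subspaceT => x.
  by rewrite inE => /in_ball /He [cx _]; exact: cinv_continuous.
pose rho q := if `[< cdom c q >] then r (cmap c q) else 0.
have rho0 q : ~ (cinv c @` K0) q -> rho q = 0.
  rewrite /rho; case: asboolP => // cq Kq; apply: r0; rewrite leNgt; apply/negP => /ltW h.
  by apply: Kq; exists (cmap c q); rewrite ?cmapK.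
have near0 q : ~ (cinv c @` K0) q -> \forall q' \near q, rho q' = 0.
  move=> Kq; have : open (~` (cinv c @` K0)) by rewrite openC.
  move=> oK; have : nbhs q (~` (cinv c @` K0)) by apply: open_nbhs_nbhs; split.
  by apply: filterS => q' /rho0.
have rhoE q : cdom c q -> rho q = r (cmap c q) by rewrite /rho => cq; case: asboolP.
exists rho; split.
- apply/smooth_funP => q; have [cq|cq] := pselect (cdom c q); last first.
    apply: (@near_eq_smooth_near _ (fun=> 0)); last exact: smooth_near_cst.
    have := near0 q; suff Kq : ~ (cinv c @` K0) q.
      by move=> /(_ Kq); apply: filterS => ? ->.
    by move=> [x /in_ball /He [[q' cq' <-] _] qE]; apply: cq; rewrite -qE cmapK.
  exists c; split=> //; apply: near_eq_smooth_at (sr (cmap c q)).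
  by apply: filterS (cinvK_near cq) => x [cx cK']; rewrite /= rhoE // cK'.
- have := cmap_near cp r1; apply: filterS2 (cdom_near cp) => q cq.
  by rewrite rhoE.
- move=> q; have [[x Kx <-]|Kq] := pselect ((cinv c @` K0) q); last by right; exact: near0.
  by left; have [] := He _ (in_ball _ Kx).
Qed.

(** The tool that makes local functions global: around each point either [f] is smooth or the
    product is identically 0. *)
Lemma smooth_cutoff (P : set M) (rho f : M -> R) : smooth_fun rho ->
  (forall q, (\forall q' \near q, P q') \/ (\forall q' \near q, rho q' = 0)) ->
  (forall q, nbhs q P -> smooth_near q f) ->
  smooth_fun (fun q => rho q * f q).
Proof.
move=> /smooth_funP srho cut sf; apply/smooth_funP => q.
have [Pq|rq] := cut q; first exact: smooth_nearM (srho q) (sf q Pq).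
apply: (@near_eq_smooth_near _ (fun=> 0)); last exact: smooth_near_cst.
by apply: filterS rq => q' ->; rewrite mul0r.
Qed.

End LocalSmoothness.

(** * Derivations at a point: algebra and locality *)

Section TangentVectors.
Context {R : realType} {n : nat} {M : smooth_manifold R n}.
Implicit Types (f g : M -> R) (p q : M) (v w : functional M).

Lemma tangentD p v f g : tangent p v -> smooth_fun f -> smooth_fun g ->
  v (fun q => f q + g q) = v f + v g.
Proof.
move=> tv sf sg; have := tangent_linear tv 1 sf sg; rewrite mul1r => <-.
by congr v; apply/funext => q; rewrite mul1r.
Qed.

Lemma tangent_cst p v (a : R) : tangent p v -> v (fun=> a) = 0.
Proof.
move=> tv; have s1 := @smooth_fun_cst R n M 1.
have v1 : v (fun=> 1) = 0.
  have := tangent_leibniz tv s1 s1; under eq_fun do rewrite mulr1.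
  by rewrite !mul1r => /eqP; rewrite -subr_eq subrr eq_sym => /eqP.
have v0 : v (fun=> 0) = 0.
  have s0 := @smooth_fun_cst R n M 0; have := tangentD tv s0 s0.
  under eq_fun do rewrite addr0.
  by move=> /eqP; rewrite -subr_eq subrr eq_sym => /eqP.
have := tangent_linear tv a s1 (@smooth_fun_cst R n M 0).
by under eq_fun do rewrite mulr1 addr0; rewrite v1 v0 mulr0 addr0.
Qed.

Lemma tangentZ p v a f : tangent p v -> smooth_fun f ->
  v (fun q => a * f q) = a * v f.
Proof.
move=> tv sf; rewrite (tangent_leibniz tv (smooth_fun_cst a) sf).
by rewrite (tangent_cst a tv) mulr0 addr0.
Qed.

Lemma tangentN p v f : tangent p v -> smooth_fun f -> v (fun q => - f q) = - v f.
Proof.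
by move=> tv sf; under eq_fun do rewrite -mulN1r; rewrite (tangentZ _ tv) // mulN1r.
Qed.

Lemma tangentB p v f g : tangent p v -> smooth_fun f -> smooth_fun g ->
  v (fun q => f q - g q) = v f - v g.
Proof.
move=> tv sf sg; rewrite (tangentD tv sf (smooth_funN sg)).
by rewrite (tangentN tv).
Qed.

Lemma tangent_sum p v (I : Type) (s : seq I) (P : pred I) (F : I -> M -> R) :
  tangent p v -> (forall i, smooth_fun (F i)) ->
  v (fun q => \sum_(i <- s | P i) F i q) = \sum_(i <- s | P i) v (F i).
Proof.
move=> tv sF; elim: s => [|i s IH].
  by under eq_fun do rewrite big_nil; rewrite (tangent_cst _ tv) big_nil.
under eq_fun do rewrite big_cons; rewrite big_cons; case: (P i) => //.
by rewrite (tangentD tv) // ?IH //; exact: smooth_fun_sum.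
Qed.

(** Locality of derivations. A plateau [rho] supported where [f = g] makes [rho * (f - g)]
    identically 0; since [rho p = 1] and [f p = g p], the Leibniz rule at [p] leaves v(f - g) =
    0. *)
Lemma near_eq_tangent p v f g : tangent p v -> smooth_fun f -> smooth_fun g ->
  (\forall q \near p, f q = g q) -> v f = v g.
Proof.
move=> tv sf sg fg; have [rho [srho rho1 cut]] := plateau fg.
have fg0 : (fun q => rho q * (f q - g q)) = fun=> 0.
  apply/funext => q; have [/nbhs_singleton ->|/nbhs_singleton ->] := cut q.
    by rewrite subrr mulr0.
  by rewrite mul0r.
have := tangent_leibniz tv srho (smooth_funB sf sg).
rewrite fg0 (tangent_cst _ tv) (nbhs_singleton rho1) mul1r.
rewrite (nbhs_singleton fg) subrr mul0r addr0 (tangentB tv) //.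
by move=> /esym/eqP; rewrite subr_eq0 => /eqP.
Qed.

Lemma functionalD v w f : (v + w) f = v f + w f. Proof. by []. Qed.

Lemma functionalZ (a : R) v f : (a *: v) f = a * v f. Proof. by []. Qed.

Lemma functionalN v f : (- v) f = - v f. Proof. by []. Qed.

Lemma functional0 f : (0 : functional M) f = 0. Proof. by []. Qed.

Lemma functional_sum (I : Type) (s : seq I) (P : pred I) (V : I -> functional M) f :
  (\sum_(i <- s | P i) V i) f = \sum_(i <- s | P i) V i f.
Proof. by rewrite (@big_morph _ _ (fun v : functional M => v f) 0 +%R). Qed.

Lemma tangent_comb p a v w : tangent p v -> tangent p w -> tangent p (a *: v + w).
Proof.
move=> tv tw; split=> [f nf|b f g sf sg|f g sf sg]; rewrite !functionalD !functionalZ.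
- by rewrite (tangent_junk tv nf) (tangent_junk tw nf) mulr0 addr0.
- by rewrite (tangent_linear tv) // (tangent_linear tw) //; ring.
- by rewrite (tangent_leibniz tv) // (tangent_leibniz tw) //; ring.
Qed.

Lemma tangent0 p : tangent p (0 : functional M).
Proof. by split=> [f _|b f g _ _|f g _ _]; rewrite !functional0 ?mulr0 ?addr0. Qed.

Lemma tangent_add p v w : tangent p v -> tangent p w -> tangent p (v + w).
Proof. by move=> tv tw; rewrite -[v]scale1r; exact: tangent_comb. Qed.

Lemma tangent_scale p a v : tangent p v -> tangent p (a *: v).
Proof. by move=> tv; rewrite -[_ *: _]addr0; exact: tangent_comb (tangent0 p). Qed.

Lemma tangent_opp p v : tangent p v -> tangent p (- v).
Proof. by move=> tv; rewrite -scaleN1r; exact: tangent_scale. Qed.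

Lemma tangent_sub p v w : tangent p v -> tangent p w -> tangent p (v - w).
Proof. by move=> tv tw; apply: tangent_add => //; exact: tangent_opp. Qed.

Lemma tangent_lincomb p (I : Type) (s : seq I) (a : I -> R) (V : I -> functional M) :
  (forall i, tangent p (V i)) -> tangent p (\sum_(i <- s) a i *: V i).
Proof.
move=> tV; elim: s => [|i s IH]; first by rewrite big_nil; exact: tangent0.
by rewrite big_cons; exact: tangent_comb.
Qed.

Lemma eq_tangent p v w : tangent p v -> tangent p w ->
  (forall f, smooth_fun f -> v f = w f) -> v = w.
Proof.
move=> tv tw vw; apply/funext => f; have [/vw//|nf] := pselect (smooth_fun f).
by rewrite (tangent_junk tv nf) (tangent_junk tw nf).
Qed.

End TangentVectors.

(** * Coordinate fields cut off to global fields *)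

Section Frame.
Context {R : realType} {n : nat} {M : smooth_manifold R n}.

(** The [i]-th coordinate derivation times [rho]. The value 0 on non-smooth functions is imposed by
    [tangent_junk]. *)
Definition chart_field (c : chart R n M) (rho : M -> R) (i : 'I_n) : field M :=
  fun q f => if `[< smooth_fun f >] then
    rho q * 'D_(delta_mx 0 i) (f \o cinv c) (cmap c q) else 0.

Definition chart_coord (c : chart R n M) (rho : M -> R) (i : 'I_n) : M -> R :=
  fun q => rho q * cmap c q 0 i.

Variables (c : chart R n M) (rho : M -> R).
Hypotheses (ac : atlas c) (srho : smooth_fun rho)
  (cut : forall q : M, (\forall q' \near q, cdom c q') \/ (\forall q' \near q, rho q' = 0)).

Lemma chart_fieldE i q f : smooth_fun f ->
  chart_field c rho i q f = rho q * 'D_(delta_mx 0 i) (f \o cinv c) (cmap c q).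
Proof. by rewrite /chart_field; case: asboolP. Qed.

Lemma chart_differentiable q f : cdom c q -> smooth_fun f ->
  differentiable (f \o cinv c) (cmap c q).
Proof.
move=> cq /smooth_funP sf.
exact: (nbhs_singleton (smooth_at_diff (smooth_near_chart ac cq (sf q)))).
Qed.

Lemma chart_coord_smooth i : smooth_fun (chart_coord c rho i).
Proof.
apply: smooth_cutoff cut _ => // q /nbhs_singleton cq; exists c; split=> //.
apply: (@near_eq_smooth_at _ _ (fun x => x 0 i)).
  by apply: filterS (cinvK_near cq) => x [_ xK]; rewrite /= xK.
by apply: smooth_genP; exact: SmoothCoord.
Qed.

Lemma chart_field_vector i : vector_field (chart_field c rho i).
Proof.
split=> [q|f sf].
  have [cq|/nbhs_singleton r0] := cut q; last first.
    suff -> : chart_field c rho i q = 0 by exact: tangent0.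
    by apply/funext => f; rewrite /chart_field r0 mul0r if_same.
  move: cq => /nbhs_singleton cq; split=> [f nf|a f g sf sg|f g sf sg].
  - by rewrite /chart_field; case: asboolP.
  - have df := chart_differentiable cq sf; have dg := chart_differentiable cq sg.
    rewrite !chart_fieldE //; last first.
      by apply: smooth_funD sg; apply: smooth_funM sf; exact: smooth_fun_cst.
    rewrite (_ : _ \o cinv c = (a *: (f \o cinv c)) + (g \o cinv c)) //.
    rewrite deriveD ?deriveZ; try exact: diff_derivable.
      by rewrite /GRing.scale /=; ring.
    by apply: derivableZ; exact: diff_derivable.
  - have df := chart_differentiable cq sf; have dg := chart_differentiable cq sg.
    rewrite !chart_fieldE //; last exact: smooth_funM.
    rewrite (_ : _ \o cinv c = (f \o cinv c) * (g \o cinv c)) //.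
    rewrite deriveM; try exact: diff_derivable.
    by rewrite /= cmapK // /GRing.scale /=; ring.
rewrite (_ : (fun p => _) = fun p => rho p * 'D_(delta_mx 0 i) (f \o cinv c) (cmap c p)).
  apply: (@smooth_cutoff _ _ _ (cdom c)) => // q /nbhs_singleton cq; exists c; split=> //.
  apply: (@near_eq_smooth_at _ _ ('D_(delta_mx 0 i) (f \o cinv c))).
    by apply: filterS (cinvK_near cq) => x [_ xK]; rewrite /= xK.
  by apply: smooth_at_partial; apply: smooth_near_chart => //; move/smooth_funP: sf.
by apply/funext => p; exact: chart_fieldE.
Qed.

Lemma chart_field_coord i j (q : M) : cdom c q -> (\forall q' \near q, rho q' = 1) ->
  chart_field c rho i q (chart_coord c rho j) = (i == j)%:R.
Proof.
move=> cq r1; rewrite chart_fieldE; last exact: chart_coord_smooth.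
rewrite (nbhs_singleton r1) mul1r.
rewrite (@near_eq_derive _ _ _ _ (fun x : 'rV[R]_n => x 0 j)); last first.
  have := cinv_near cq r1; apply: filterS2 (cinvK_near cq) => x [_ xK].
  by rewrite /= /chart_coord xK => ->; rewrite mul1r.
have := @derive_id R 'rV[R]_n (cmap c q) (delta_mx 0 i).
rewrite derive_mx; last exact: derivable_id.
by move=> /matrixP /(_ 0 j); rewrite !mxE eqxx eq_sym => ->.
Qed.

(** Hadamard's lemma writes [f] near [q] as a constant plus the sum of (y_j - a_j) g_j. A derivation
    at [q] kills the constant, and since y_j - a_j vanishes at [q], the Leibniz rule leaves the sum
    of v(y_j) g_j(a). The same formula for the coordinate derivations identifies g_j(a) as the
    [j]-th one applied to [f]. *)
Lemma chart_field_span (q : M) v : cdom c q -> (\forall q' \near q, rho q' = 1) ->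
  tangent q v -> v = \sum_j v (chart_coord c rho j) *: chart_field c rho j q.
Proof.
move=> cq r1 tv; apply: (eq_tangent tv) => [|f sf].
  by apply: tangent_lincomb => j; exact: vector_field_tangent (chart_field_vector j) _.
rewrite functional_sum; set a := cmap c q.
have [r r0 Hr] : exists2 r, 0 < r & forall x, `|x - a| < r -> (cmap c @` cdom c) x.
  have /nbhs_ballP [r /= r0 Hr] := cimage_near cq; exists r => // x xr.
  by apply: Hr; rewrite -ball_normE /= distrC.
have fr x : `|x - a| < r -> smooth_at (f \o cinv c) x.
  by move=> /Hr [p cp <-]; apply: smooth_near_chart => //; move/smooth_funP: sf.
have [g [sg fg]] := hadamard fr.
pose P q' := cdom c q' /\ `|cmap c q' - a| < r.
have Pq : \forall q' \near q, P q'.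
  have := cmap_near cq (near_norm_lt (x:=a) (a:=a) (r:=r) _).
  rewrite subrr normr0 => /(_ r0); apply: filterS2 (cdom_near cq) => q' ? ?.
  by split.
have [rh [srh rh1 rhcut]] := plateau Pq.
have sgr j : smooth_fun (fun q' => rh q' * g j (cmap c q')).
  apply: smooth_cutoff rhcut _ => // q' /nbhs_singleton [cq' q'r].
  exists c; split=> //; apply: near_eq_smooth_at (sg j _ q'r).
  by apply: filterS (cinvK_near cq') => x [_ xK]; rewrite /= xK.
(* A globally smooth function equal to [f] near [q]. The factors [g j] are smooth only on the
   coordinate ball, so they are cut off by the second plateau [rh], supported there. *)
pose h q' := f q + \sum_j (chart_coord c rho j q' - a 0 j) * (rh q' * g j (cmap c q')).
have sy j := chart_coord_smooth j.
have sya j : smooth_fun (fun q' => chart_coord c rho j q' - a 0 j).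
  by apply: smooth_funB => //; exact: smooth_fun_cst.
have sh : smooth_fun h.
  apply: smooth_funD; first exact: smooth_fun_cst.
  by apply: smooth_fun_sum => j; exact: smooth_funM.
have fh : \forall q' \near q, f q' = h q'.
  near=> q'.
  have [cq' q'r] : P q' by near: q'.
  have -> : f q' = (f \o cinv c) (cmap c q') by rewrite /= cmapK.
  rewrite (fg _ q'r) /h /= /a cmapK //; congr (_ + _); apply: eq_bigr => j _.
  by rewrite /chart_coord (near r1 q') // (near rh1 q') // !mul1r.
have wf w : tangent q w -> w f = \sum_j w (chart_coord c rho j) * g j a.
  move=> tw; rewrite (near_eq_tangent tw sf sh fh) /h.
  rewrite (tangentD tw) //; first last.
  - by apply: smooth_fun_sum => j; exact: smooth_funM.
  - exact: smooth_fun_cst.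
  rewrite (tangent_cst _ tw) add0r (tangent_sum _ _ tw); last first.
    by move=> j; exact: smooth_funM.
  apply: eq_bigr => j _; rewrite (tangent_leibniz tw) //.
  rewrite /chart_coord (nbhs_singleton r1) (nbhs_singleton rh1) !mul1r.
  rewrite -/a subrr mul0r add0r mulrC; congr (_ * _).
  rewrite (tangentB tw (sy j)); last exact: smooth_fun_cst.
  by rewrite (tangent_cst _ tw) subr0.
rewrite wf //; apply: eq_bigr => j _; rewrite functionalZ; congr (_ * _).
rewrite wf; last exact: vector_field_tangent (chart_field_vector j) _.
rewrite (bigD1 j) //= big1 ?addr0 => [|i ij].
  by rewrite chart_field_coord // eqxx mul1r.
by rewrite chart_field_coord // eq_sym (negPf ij) mul0r.
Unshelve. all: by end_near. Qed.

End Frame.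

Lemma local_frame (R : realType) n (M : smooth_manifold R n) (p : M) :
  exists (E : 'I_n -> field M) (y : 'I_n -> M -> R),
    [/\ forall i, vector_field (E i), forall i, smooth_fun (y i),
      \forall q \near p, forall i j, E i q (y j) = (i == j)%:R &
      \forall q \near p, forall v, tangent q v -> v = \sum_i v (y i) *: E i q].
Proof.
have [c ac cp] := atlas_cover p.
have [rho [srho /nbhs_interior rho1 cut]] := plateau (cdom_near cp).
exists (chart_field c rho), (chart_coord c rho); split.
- by move=> i; exact: chart_field_vector.
- by move=> i; exact: chart_coord_smooth.
- by apply: filterS2 (cdom_near cp) rho1 => q cq r1 i j; exact: chart_field_coord.
- by apply: filterS2 (cdom_near cp) rho1 => q cq r1 v; exact: chart_field_span.
Qed.

(** * Vector fields, metrics and gradients *)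

Section VectorFields.
Context {R : realType} {n : nat} {M : smooth_manifold R n}.
Implicit Types (X Y : field M) (f : M -> R).

Lemma vector_fieldD X Y : vector_field X -> vector_field Y ->
  vector_field (fun q => X q + Y q).
Proof.
move=> [tX sX] [tY sY]; split=> [p|f sf]; first exact: tangent_add.
by apply: smooth_funD; [exact: sX|exact: sY].
Qed.

Lemma vector_fieldM f X : smooth_fun f -> vector_field X ->
  vector_field (fun q => f q *: X q).
Proof.
move=> sf [tX sX]; split=> [p|h sh]; first exact: tangent_scale.
by apply: smooth_funM => //; exact: sX.
Qed.

Lemma vector_fieldN X : vector_field X -> vector_field (fun q => - X q).
Proof.
move=> [tX sX]; split=> [p|h sh]; first exact: tangent_opp.
by apply: smooth_funN; exact: sX.
Qed.

Lemma vector_field_bracket X Y : vector_field X -> vector_field Y ->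
  vector_field (bracket X Y).
Proof.
move=> [tX sX] [tY sY]; split=> [p|f sf]; last first.
  by apply: smooth_funB; [apply: sX; exact: sY|apply: sY; exact: sX].
split=> [f nf|a f g sf sg|f g sf sg]; rewrite /bracket.
- under eq_fun do rewrite (tangent_junk (tY _) nf).
  under [in X in _ - X]eq_fun do rewrite (tangent_junk (tX _) nf).
  by rewrite (tangent_cst _ (tX p)) (tangent_cst _ (tY p)) subr0.
- under eq_fun do rewrite (tangent_linear (tY _) _ sf sg).
  under [in X in _ - X]eq_fun do rewrite (tangent_linear (tX _) _ sf sg).
  rewrite (tangent_linear (tX p)) ?(tangent_linear (tY p)); try by [exact: sX|exact: sY].
  by ring.
- under eq_fun do rewrite (tangent_leibniz (tY _) sf sg).
  under [in X in _ - X]eq_fun do rewrite (tangent_leibniz (tX _) sf sg).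
  have [sXf sXg sYf sYg] : [/\ smooth_fun (fun q => X q f), smooth_fun (fun q => X q g),
    smooth_fun (fun q => Y q f) & smooth_fun (fun q => Y q g)].
    by split; [exact: sX|exact: sX|exact: sY|exact: sY].
  rewrite (tangentD (tX p)) ?(tangentD (tY p)); try exact: smooth_funM.
  rewrite !(tangent_leibniz (tX p)) // !(tangent_leibniz (tY p)) //.
  by ring.
Qed.

End VectorFields.

(** * Pointwise algebra of a Riemannian metric *)

Section Metric.
Context {R : realType} {n : nat} {M : smooth_manifold R n}.
Variables (g : M -> functional M -> functional M -> R).
Hypothesis rg : riemannian_metric g.
Implicit Types (p : M) (u v w : functional M).

Lemma metric0l p w : tangent p w -> g p 0 w = 0.
Proof.
move=> tw; have := metric_linear rg (-1) tw tw tw.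
by rewrite scaleN1r addNr mulN1r addNr.
Qed.

Lemma metricDl p u v w : tangent p u -> tangent p v -> tangent p w ->
  g p (u + v) w = g p u w + g p v w.
Proof. by move=> tu tv tw; rewrite -{1}[u]scale1r (metric_linear rg) // mul1r. Qed.

Lemma metricZl p a u w : tangent p u -> tangent p w -> g p (a *: u) w = a * g p u w.
Proof.
move=> tu tw; rewrite -[a *: u]addr0 (metric_linear rg) //; last exact: tangent0.
by rewrite metric0l // addr0.
Qed.

Lemma metricNl p u w : tangent p u -> tangent p w -> g p (- u) w = - g p u w.
Proof. by move=> tu tw; rewrite -scaleN1r metricZl // mulN1r. Qed.

Lemma metricBl p u v w : tangent p u -> tangent p v -> tangent p w ->
  g p (u - v) w = g p u w - g p v w.
Proof. by move=> tu tv tw; rewrite metricDl ?metricNl //; exact: tangent_opp. Qed.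

Lemma metricDr p u v w : tangent p u -> tangent p v -> tangent p w ->
  g p w (u + v) = g p w u + g p w v.
Proof.
move=> tu tv tw; rewrite (Defs.metric_sym rg) ?metricDl //; last exact: tangent_add.
by rewrite (Defs.metric_sym rg tu tw) (Defs.metric_sym rg tv tw).
Qed.

Lemma metricZr p a u w : tangent p u -> tangent p w -> g p w (a *: u) = a * g p w u.
Proof.
move=> tu tw; rewrite (Defs.metric_sym rg) ?metricZl //; last exact: tangent_scale.
by rewrite (Defs.metric_sym rg tu tw).
Qed.

Lemma metricNr p u w : tangent p u -> tangent p w -> g p w (- u) = - g p w u.
Proof. by move=> tu tw; rewrite -scaleN1r metricZr // mulN1r. Qed.

Lemma metric_suml p (I : Type) (s : seq I) (a : I -> R) (V : I -> functional M) w :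
  (forall i, tangent p (V i)) -> tangent p w ->
  g p (\sum_(i <- s) a i *: V i) w = \sum_(i <- s) a i * g p (V i) w.
Proof.
move=> tV tw; elim: s => [|i s IH]; first by rewrite !big_nil metric0l.
by rewrite !big_cons (metric_linear rg) ?IH //; exact: tangent_lincomb.
Qed.

Lemma metric_sumr p (I : Type) (s : seq I) (a : I -> R) (V : I -> functional M) w :
  (forall i, tangent p (V i)) -> tangent p w ->
  g p w (\sum_(i <- s) a i *: V i) = \sum_(i <- s) a i * g p w (V i).
Proof.
move=> tV tw; rewrite (Defs.metric_sym rg) ?metric_suml //; last exact: tangent_lincomb.
by apply: eq_bigr => i _; rewrite (Defs.metric_sym rg (tV i) tw).
Qed.

Lemma metric_ge0 p v : tangent p v -> 0 <= g p v v.
Proof.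
move=> tv; have [->|v0] := eqVneq v 0; first by rewrite metric0l //; exact: tangent0.
exact: ltW (Defs.metric_pos rg tv v0).
Qed.

Lemma metric_eq0 p v : tangent p v -> g p v v = 0 -> v = 0.
Proof.
move=> tv gv; have [//|v0] := eqVneq v 0.
by have := metric_pos rg tv v0; rewrite gv ltxx.
Qed.

(** If [u] is in the kernel, the combination of the [E i] with coefficients [u] has square norm 0,
    so it is 0 by definiteness and [u] is 0 by freeness. *)
Lemma gram_unit p (I : nat) (E : 'I_I -> functional M) :
  (forall i, tangent p (E i)) ->
  (forall a : 'I_I -> R, \sum_i a i *: E i = 0 -> forall i, a i = 0) ->
  (\matrix_(i, j) g p (E i) (E j)) \in unitmx.
Proof.
move=> tE free; rewrite -row_free_unit; apply: inj_row_free => u uG.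
apply/rowP => k; rewrite mxE; apply: (free (fun i => u 0 i)).
apply: (@metric_eq0 p); first exact: tangent_lincomb.
rewrite metric_sumr //; last exact: tangent_lincomb.
apply: big1 => j _; rewrite metric_suml //.
have /rowP /(_ j) := uG; rewrite !mxE.
under eq_bigr do rewrite mxE.
by move=> ->; rewrite mulr0.
Qed.

End Metric.

Section SmoothMatrix.
Context {R : realType} {n : nat} {M : smooth_manifold R n}.

Lemma smooth_near_det m (A : M -> 'M[R]_m) p :
  (forall i j, smooth_near p (fun q => A q i j)) -> smooth_near p (fun q => \det (A q)).
Proof.
move=> sA; apply: smooth_near_sum => s; apply: smooth_nearM; first exact: smooth_near_cst.
by apply: smooth_near_prod => i; exact: sA.
Qed.

(** Cramer's formula: a cofactor divided by the determinant. *)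
Lemma smooth_near_invmx m (A : M -> 'M[R]_m) p i j :
  (forall i j, smooth_near p (fun q => A q i j)) ->
  (\forall q \near p, A q \in unitmx) -> smooth_near p (fun q => invmx (A q) i j).
Proof.
move=> sA uA.
apply: (@near_eq_smooth_near _ _ _ _ (fun q => (\det (A q))^-1 *
    ((-1) ^+ (j + i) * \det (row' j (col' i (A q)))))).
  by apply: filterS uA => q uq; rewrite /invmx uq !mxE.
apply: smooth_nearM.
  apply: smooth_nearV; last exact: smooth_near_det.
  by have := nbhs_singleton uA; rewrite unitmxE unitfE.
apply: smooth_nearM; first exact: smooth_near_cst.
apply: smooth_near_det => k l.
by under eq_fun do rewrite !mxE; exact: sA.
Qed.

End SmoothMatrix.

(** [G] is [rho] times the gradient of [f], whose coefficients in a local frame come from the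
    inverse Gram matrix applied to the [E i f]. The identity is kept at every [q], not only at [p],
    because it shows [G] to be orthogonal to the kernel of df everywhere; this makes it a global
    horizontal field when [f] is pulled back from the base. *)
Lemma gradient_cutoff (R : realType) n (M : smooth_manifold R n)
    (g : M -> functional M -> functional M -> R) (f : M -> R) (p : M) :
  riemannian_metric g -> smooth_fun f ->
  exists (G : field M) (rho : M -> R), [/\ vector_field G, rho p = 1 &
    forall q w, tangent q w -> g q (G q) w = rho q * w f].
Proof.
move=> rg sf; have [E [y [vE sy dE sE]]] := local_frame p.
pose P q := (forall i j, E i q (y j) = (i == j)%:R) /\
  (forall v, tangent q v -> v = \sum_i v (y i) *: E i q).
have Pp : \forall q \near p, P q by apply: filterS2 dE sE => q; split.
have [rho [srho rho1 cut]] := plateau Pp.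
pose A q := \matrix_(i, j) g q (E i q) (E j q).
have tE i q : tangent q (E i q) := vector_field_tangent (vE i) q.
have uA q : P q -> A q \in unitmx.
  move=> [dq _]; apply: (gram_unit rg) => [i|a aE k]; first exact: tE.
  have : (\sum_i a i *: E i q) (y k) = (0 : functional M) (y k) by rewrite aE.
  rewrite functional_sum functional0 (bigD1 k) //= big1 ?addr0 => [|i ik].
    by rewrite functionalZ dq eqxx mulr1.
  by rewrite functionalZ dq (negPf ik) mulr0.
pose b q : 'rV[R]_n := \row_i E i q f.
pose c q := b q *m invmx (A q).
pose G q : functional M := rho q *: \sum_j c q 0 j *: E j q.
have tG q : tangent q (G q) by apply: tangent_scale; apply: tangent_lincomb => j; exact: tE.
exists G, rho; split; last 2 first.
- exact: (nbhs_singleton rho1).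
- move=> q w tw; rewrite /G (metricZl rg) //; last first.
    by apply: tangent_lincomb => j; exact: tE.
  have [/nbhs_singleton Pq|/nbhs_singleton ->] := cut q; last by rewrite !mul0r.
  congr (_ * _); rewrite [in RHS](Pq.2 _ tw) functional_sum {1}(Pq.2 _ tw).
  rewrite (metric_sumr rg); last 2 first.
  + by move=> i; exact: tE.
  + by apply: tangent_lincomb => j; exact: tE.
  apply: eq_bigr => k _; rewrite functionalZ; congr (_ * _).
  rewrite (metric_suml rg) //.
  have /rowP /(_ k) : c q *m A q = b q by rewrite /c mulmxKV // uA.
  by rewrite [in LHS]mxE [in RHS]mxE => <-; apply: eq_bigr => j _; rewrite [A _ _ _]mxE.
split=> // h sh.
have -> : (fun q => G q h) = fun q => rho q * \sum_j c q 0 j * E j q h.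
  by apply/funext => q; rewrite /G functionalZ functional_sum.
apply: (smooth_cutoff srho cut) => q /nbhs_interior Pq.
apply: smooth_near_sum => j; apply: smooth_nearM; last first.
  by have /smooth_funP := vector_field_smooth (vE j) sh.
under eq_fun do rewrite mxE; apply: smooth_near_sum => i; apply: smooth_nearM.
  under eq_fun do rewrite mxE.
  by have /smooth_funP := vector_field_smooth (vE i) sf.
apply: smooth_near_invmx => [k l|].
  under eq_fun do rewrite mxE.
  by have /smooth_funP := metric_smooth rg (vE k) (vE l).
by apply: filterS Pq => q' /interior_subset /uA.
Qed.

(** * Riemannian submersions *)

Section Submersion.
Context {R : realType} {m n : nat}.
Context {M : smooth_manifold R m} {N : smooth_manifold R n}.
Variables (F : M -> N) (gM : M -> functional M -> functional M -> R)
  (gN : N -> functional N -> functional N -> R).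
Hypotheses (rM : riemannian_metric gM) (rN : riemannian_metric gN)
  (sub : riemannian_submersion F gM gN).

Lemma smooth_fun_comp (h : N -> R) : smooth_fun h -> smooth_fun (h \o F).
Proof.
move=> /smooth_funP sh; apply/smooth_funP => p.
have [cF sF] := rsub_smooth sub.
have [c ac cp] := atlas_cover p; have [d [ad dp hd]] := sh (F p).
exists c; split=> //.
have rowE x : \row_j cmap d (F (cinv c x)) 0 j = cmap d (F (cinv c x)).
  by apply/rowP => j; rewrite mxE.
have dF := cinv_near cp (cF p _ (cdom_near dp)).
apply: (@near_eq_smooth_at R m
    (fun x => (h \o cinv d) (\row_j cmap d (F (cinv c x)) 0 j))).
  by apply: filterS dF => x dx; rewrite rowE /= cmapK.
apply: smooth_genP.
apply: (@SmoothComp R m _ n (h \o cinv d)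
  (fun j (x : 'rV[R]_m) => cmap d (F (cinv c x)) 0 j)).
  by rewrite rowE cmapK.
move=> j; apply: SmoothBase; apply: (smooth_on_at (sF c d j ac ad)).
by apply: filterS2 dF (cinvK_near cp) => x dx [cx cK]; exists (cinv c x).
Qed.

Lemma pushforwardE v (h : N -> R) : smooth_fun h -> Defs.pushforward F v h = v (h \o F).
Proof. by rewrite /Defs.pushforward; case: asboolP. Qed.

Lemma pushforward_tangent p v : tangent p v -> tangent (F p) (Defs.pushforward F v).
Proof.
move=> tv; split=> [h nh|a f h sf sh|f h sf sh].
- by rewrite /Defs.pushforward; case: asboolP.
- rewrite !pushforwardE //; last first.
    by apply: smooth_funD sh; apply: smooth_funM sf; exact: smooth_fun_cst.
  by rewrite -(tangent_linear tv) //; exact: smooth_fun_comp.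
- rewrite !pushforwardE //; last exact: smooth_funM.
  by rewrite -(tangent_leibniz tv) //; exact: smooth_fun_comp.
Qed.

Lemma verticalE p v : tangent p v ->
  vertical F p v <-> forall h, smooth_fun h -> v (h \o F) = 0.
Proof.
move=> tv; split=> [[_ pv] h sh|H]; first by rewrite -pushforwardE // pv.
split=> //; apply/funext => h; rewrite /Defs.pushforward; case: asboolP => // sh.
exact: H.
Qed.

(** Maximal rank makes the gradients independent at [p]: pairing the sum of the a_i G_i with a
    vector that lifts E_j gives a_j. Their Gram matrix is then invertible, and the coefficients
    solve the linear system saying that the remainder annihilates each y_j o F, hence is
    vertical. *)
Lemma horizontal_lift p : exists G : 'I_n -> field M,
  (forall i, section_of (horizontal F gM) (G i)) /\
  forall v, tangent p v -> exists a : 'I_n -> R,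
    vertical F p (v - \sum_i a i *: G i p).
Proof.
have [E [y [vE sy /nbhs_singleton dE /nbhs_singleton sE]]] := local_frame (F p).
have sf i : smooth_fun (y i \o F) by exact: smooth_fun_comp.
have /choice[G HG] i : exists G : field M, exists rho : M -> R,
    [/\ vector_field G, rho p = 1 &
    forall q w, tangent q w -> gM q (G q) w = rho q * w (y i \o F)].
  by have [G [rho ?]] := gradient_cutoff p rM (sf i); exists G, rho.
have vG i : vector_field (G i) by have [rho []] := HG i.
have tG i q : tangent q (G i q) := vector_field_tangent (vG i) q.
have Gw i w : tangent p w -> gM p (G i p) w = w (y i \o F).
  by have [rho [_ r1 H]] := HG i; move=> tw; rewrite H // r1 mul1r.
exists G; split=> [i|v tv].
  split=> // q; split=> // w [tw vw]; have [rho [_ _ ->]] := HG i => //.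
  by rewrite (verticalE tw).1 ?mulr0.
pose K : 'M[R]_n := \matrix_(i, j) gM p (G i p) (G j p).
have uK : K \in unitmx.
  apply: (gram_unit rM) => [i|a aG j]; first exact: tG.
  have [u tu Fu] := rsub_rank sub (vector_field_tangent (vE j) (F p)).
  have := metric0l rM tu; rewrite -aG (metric_suml rM) //.
  rewrite (bigD1 j) //= big1 => [|i ij].
    by rewrite Gw // -pushforwardE // Fu dE eqxx mulr1 addr0.
  by rewrite Gw // -pushforwardE // Fu dE eq_sym (negPf ij) mulr0.
pose a : 'rV[R]_n := (\row_j v (y j \o F)) *m invmx K.
exists (fun i => a 0 i).
have tw : tangent p (v - \sum_i a 0 i *: G i p).
  by apply: tangent_sub => //; apply: tangent_lincomb => i; exact: tG.
split=> //; rewrite (sE _ (pushforward_tangent tw)); apply: big1 => j _.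
rewrite pushforwardE //= functionalD functionalN functional_sum.
have /rowP /(_ j) : a *m K = \row_j v (y j \o F) by rewrite /a mulmxKV.
rewrite mxE [in RHS]mxE => <-; rewrite -sumrB big1 ?scale0r // => i _.
rewrite functionalZ [K _ _]mxE (Defs.metric_sym rM (tG i p) (tG j p)) Gw //.
by rewrite subrr.
Qed.

Lemma horizontal_vertical p u w : horizontal F gM p u -> vertical F p w -> gM p u w = 0.
Proof. by move=> [_]; exact. Qed.

Lemma vertical_horizontal p u w : horizontal F gM p u -> vertical F p w -> gM p w u = 0.
Proof.
move=> [tu hu] vw; rewrite (Defs.metric_sym rM vw.1 tu); exact: hu.
Qed.

Lemma horizontal_lincomb p (I : Type) (s : seq I) (a : I -> R) (V : I -> functional M) :
  (forall i, horizontal F gM p (V i)) -> horizontal F gM p (\sum_(i <- s) a i *: V i).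
Proof.
move=> hV; have tV i : tangent p (V i) by have [] := hV i.
split=> [|w vw]; first exact: tangent_lincomb.
rewrite (metric_suml rM) //; last by have [] := vw.
by apply: big1 => i _; rewrite (horizontal_vertical (hV i) vw) mulr0.
Qed.

(** Take the fields of [horizontal_lift] with constant coefficients; at [p] the remainder is both
    horizontal and vertical, thus orthogonal to itself. *)
Lemma horizontal_extension p z : horizontal F gM p z ->
  exists2 Z, section_of (horizontal F gM) Z & Z p = z.
Proof.
move=> hz; have [G [sG lift]] := horizontal_lift p; have [a va] := lift z hz.1.
have hS : horizontal F gM p (\sum_i a i *: G i p).
  by apply: horizontal_lincomb => i; exact: (sG i).2.
exists (fun q => \sum_i a i *: G i q).
  split=> [|q]; last by apply: horizontal_lincomb => i; exact: (sG i).2.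
  split=> [q|f sf].
    by apply: tangent_lincomb => i; have [/vector_field_tangent] := sG i.
  under eq_fun do rewrite functional_sum.
  apply: smooth_fun_sum => i; apply: smooth_funM; first exact: smooth_fun_cst.
  exact: (vector_field_smooth (sG i).1 sf).
apply/esym/eqP; rewrite -subr_eq0; apply/eqP; apply: (metric_eq0 rM va.1).
by rewrite (metricBl rM hz.1 hS.1 va.1) !horizontal_vertical // subrr.
Qed.

(** Polarization: the submersion condition speaks of lengths only, and is applied to [u], [v] and
    [u + v]. *)
Lemma pushforward_isometry p u v : horizontal F gM p u -> horizontal F gM p v ->
  gN (F p) (Defs.pushforward F u) (Defs.pushforward F v) = gM p u v.
Proof.
have norm w : horizontal F gM p w ->
    gN (F p) (Defs.pushforward F w) (Defs.pushforward F w) = gM p w w.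
  move=> hw; have := rsub_isometry sub hw; rewrite /vlength.
  have gN0 := metric_ge0 rN (pushforward_tangent hw.1).
  have gM0 := metric_ge0 rM hw.1.
  by move=> /(congr1 (fun x => x ^+ 2)); rewrite !sqr_sqrtr.
move=> hu hv; have huv : horizontal F gM p (u + v).
  split=> [|w vw]; first by apply: tangent_add; [exact: hu.1|exact: hv.1].
  by rewrite (metricDl rM hu.1 hv.1 vw.1) !horizontal_vertical // addr0.
have := norm _ huv.
have -> : Defs.pushforward F (u + v) = Defs.pushforward F u + Defs.pushforward F v.
  apply/funext => h; rewrite functionalD /Defs.pushforward.
  by case: ifP => _; rewrite ?addr0.
have [tu tv] := (pushforward_tangent hu.1, pushforward_tangent hv.1).
rewrite !(metricDl rN, metricDr rN, metricDl rM, metricDr rM) //;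
  try (by apply: tangent_add) ; try (by have [] := hu); try (by have [] := hv).
  rewrite !norm // (Defs.metric_sym rN tv tu) (Defs.metric_sym rM hv.1 hu.1); lra.
by apply: tangent_add; [exact: hu.1|exact: hv.1].
Qed.

(* Near [p] the function [gM X X] is [sum_ij X(f_i) X(f_j) (gN_ij o F)] with
   [f_i = y_i o F]; a vertical field [V] annihilates [f_i] and [gN_ij o F], so that
   differentiating along [V] replaces [X(f_i)] by [[V, X](f_i)]. *)
Lemma vertical_killing V X p : section_of (vertical F) V ->
  section_of (horizontal F gM) X ->
  V p (fun q => gM q (X q) (X q)) = 2 * gM p (bracket V X p) (X p).
Proof.
move=> [vV verV] [vX horX].
have [E [y [vE sy _ sE]]] := local_frame (F p).
have sf i : smooth_fun (y i \o F) by exact: smooth_fun_comp.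
pose gij i j q := gN q (E i q) (E j q).
have sgN i j : smooth_fun (gij i j) by exact: metric_smooth.
have sg i j : smooth_fun (gij i j \o F) by exact: smooth_fun_comp.
have tX q : tangent q (X q) := vector_field_tangent vX q.
have tV q : tangent q (V q) := vector_field_tangent vV q.
have sXf i : smooth_fun (fun q => X q (y i \o F)) := vector_field_smooth vX (sf i).
have gNE q u v : (forall v, tangent (F q) v -> v = \sum_i v (y i) *: E i (F q)) ->
    tangent q u -> tangent q v ->
    gN (F q) (Defs.pushforward F u) (Defs.pushforward F v) =
    \sum_i \sum_j u (y i \o F) * (v (y j \o F) * gij i j (F q)).
  move=> span tu tv; have [pu pv] := (pushforward_tangent tu, pushforward_tangent tv).
  have tE i : tangent (F q) (E i (F q)) := vector_field_tangent (vE i) (F q).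
  rewrite {1}(span _ pu) (metric_suml rN) //; apply: eq_bigr => i _.
  rewrite {1}(span _ pv) (metric_sumr rN) // mulr_sumr; apply: eq_bigr => j _.
  by rewrite !pushforwardE.
pose Th q := \sum_i \sum_j
  X q (y i \o F) * (X q (y j \o F) * (gij i j \o F) q).
have sprod i j : smooth_fun (fun q => X q (y j \o F) * (gij i j \o F) q).
  exact: smooth_funM.
have sTh1 i j : smooth_fun (fun q => X q (y i \o F) * (X q (y j \o F) * (gij i j \o F) q)).
  exact: smooth_funM.
have sTh : smooth_fun Th by do 2!apply: smooth_fun_sum => ?.
have gTh : \forall q \near p, gM q (X q) (X q) = Th q.
  have [cF _] := rsub_smooth sub.
  have : \forall q \near p, forall v, tangent (F q) v -> v = \sum_i v (y i) *: E i (F q).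
    exact: (cF p _ sE).
  apply: filterS => q span.
  by rewrite -pushforward_isometry ?gNE.
rewrite (near_eq_tangent (tV p) _ sTh gTh); last exact: metric_smooth.
have VX i : V p (fun q => X q (y i \o F)) = bracket V X p (y i \o F).
  rewrite /bracket; have -> : (fun q => V q (y i \o F)) = fun=> 0.
    by apply/funext => q; apply: (verticalE (tV q)).1.
  by rewrite (tangent_cst _ (tX p)) subr0.
have Vg i j : V p (gij i j \o F) = 0 by apply: (verticalE (tV p)).1.
have tB := vector_field_tangent (vector_field_bracket vV vX) p.
have span := nbhs_singleton sE.
have -> : V p Th = gN (F p) (Defs.pushforward F (bracket V X p)) (Defs.pushforward F (X p))
    + gN (F p) (Defs.pushforward F (X p)) (Defs.pushforward F (bracket V X p)).
  rewrite !gNE // -big_split /= (tangent_sum _ _ (tV p)); last first.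
    by move=> i; apply: smooth_fun_sum.
  apply: eq_bigr => i _; rewrite -big_split /= (tangent_sum _ _ (tV p)) //.
  apply: eq_bigr => j _; rewrite (tangent_leibniz (tV p) (sXf i) (sprod i j)).
  rewrite (tangent_leibniz (tV p) (sXf j) (sg i j)) !VX.
  have -> : V p (fun q => (gij i j \o F) q) = 0 by exact: Vg.
  by rewrite /=; ring.
have [tp tb] := (pushforward_tangent (tX p), pushforward_tangent tB).
rewrite (Defs.metric_sym rN tp tb) -mulr2n -[LHS]mulr_natl; congr (_ * _).
(* The bracket itself need not be horizontal. It is replaced by its horizontal part [h], which has
   the same pushforward, and the vertical remainder is orthogonal to [X]. *)
have [G [sG lift]] := horizontal_lift p; have [a va] := lift _ tB.
set h := \sum_i _ in va.
have hh : horizontal F gM p h by apply: horizontal_lincomb => i; exact: (sG i).2.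
have -> : Defs.pushforward F (bracket V X p) = Defs.pushforward F h.
  apply/funext => f; rewrite /Defs.pushforward; case: asboolP => // sf'.
  have := (verticalE va.1).1 va _ sf'; rewrite functionalD functionalN.
  by move=> /eqP; rewrite subr_eq0 => /eqP.
rewrite pushforward_isometry // -[in RHS](subrK h (bracket V X p)).
rewrite (metricDl rM va.1 hh.1 (tX p)) (vertical_horizontal (horX p) va).
by rewrite add0r.
Qed.

Variable nabla : field M -> field M -> field M.
Hypothesis lc : levi_civita gM nabla.

(** Differentiating g(X, V) = 0 along X gives g(nabla_X X, V) = - g(X, nabla_X V). Moreover V g(X,
    X) equals 2 g(nabla_V X, X) by metricity and 2 g(nabla_V X - nabla_X V, X) by
    [vertical_killing], so g(nabla_X V, X) = 0. *)
Lemma nabla_diag_vertical V X p : section_of (vertical F) V ->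
  section_of (horizontal F gM) X -> gM p (nabla X X p) (V p) = 0.
Proof.
move=> sV sX; have [vV verV] := sV; have [vX horX] := sX.
have tN Y Z : vector_field Y -> vector_field Z -> tangent p (nabla Y Z p).
  by move=> vY vZ; exact: vector_field_tangent (lc_field lc vY vZ) p.
have [tX tV] := (vector_field_tangent vX p, vector_field_tangent vV p).
have H1 := lc_metric lc vX vX vV p.
have XV0 : (fun q => gM q (X q) (V q)) = fun=> 0.
  by apply/funext => q; exact: horizontal_vertical.
rewrite XV0 (tangent_cst _ tX) in H1.
have H2 := lc_metric lc vV vX vX p.
rewrite (vertical_killing p sV sX) -(lc_torsion_free lc vV vX) in H2.
rewrite (metricBl rM) // ?(Defs.metric_sym rM tX) // in H2; try exact: tN.
rewrite (Defs.metric_sym rM tX) // in H1; last exact: tN.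
lra.
Qed.

(** Polarization of [nabla_diag_vertical] at X + Y; this is the skew-symmetry of O'Neill's tensor A
    on horizontal fields. *)
Lemma nabla_skew V X Y p : section_of (vertical F) V ->
  section_of (horizontal F gM) X -> section_of (horizontal F gM) Y ->
  gM p (nabla X Y p) (V p) = - gM p (nabla Y X p) (V p).
Proof.
move=> sV sX sY; have [vX hX] := sX; have [vY hY] := sY.
have vXY := vector_fieldD vX vY.
have tN A B : vector_field A -> vector_field B -> tangent p (nabla A B p).
  by move=> vA vB; exact: vector_field_tangent (lc_field lc vA vB) p.
have tV := vector_field_tangent sV.1 p.
have sXY : section_of (horizontal F gM) (fun q => X q + Y q).
  split=> // q; split=> [|w vw]; first exact: vector_field_tangent vXY q.
  by rewrite (metricDl rM (hX q).1 (hY q).1 vw.1) !horizontal_vertical // addr0.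
have := nabla_diag_vertical p sV sXY.
have E1 Z : vector_field Z -> nabla (fun q => X q + Y q) Z p = nabla X Z p + nabla Y Z p.
  move=> vZ; have := lc_linearl lc (smooth_fun_cst 1) vX vY vZ p.
  by under eq_fun do rewrite scale1r; rewrite scale1r.
rewrite (lc_addr lc vXY vX vY) !E1 // !(metricDl rM) //;
  try by [exact: tN|apply: tangent_add; exact: tN].
rewrite !nabla_diag_vertical // add0r addr0 => /eqP.
by rewrite addr_eq0 => /eqP ->; rewrite opprK.
Qed.

End Submersion.

(** * Cosymplectic structures *)

Section Cosymplectic.
Context {R : realType} {n : nat} {M : smooth_manifold R n}.
Variables (phi : M -> functional M -> functional M) (xi : field M)
  (eta : M -> functional M -> R) (g : M -> functional M -> functional M -> R)
  (nabla : field M -> field M -> field M).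
Hypotheses (cs : cosymplectic phi xi eta g) (lc : levi_civita g nabla).
Implicit Types (X Y Z W : field M) (p : M) (u v w : functional M).

Let acm := cosymplectic_acm cs.
Let rg := acm_g acm.
Let ph X : field M := fun q => phi q (X q).
Let vxi : vector_field xi := acm_xi acm.

Lemma vector_field_phi X : vector_field X -> vector_field (ph X).
Proof. exact: endo_field_smooth (acm_phi acm) X. Qed.

Lemma vector_field_nabla X Y : vector_field X -> vector_field Y ->
  vector_field (nabla X Y).
Proof. exact: lc_field lc X Y. Qed.

Lemma field_tangent X p : vector_field X -> tangent p (X p).
Proof. by move=> vX; exact: vector_field_tangent. Qed.

Lemma phi_tangent p v : tangent p v -> tangent p (phi p v).
Proof. exact: endo_field_tangent (acm_phi acm) p v. Qed.

Lemma nabla_tangent X Y p : vector_field X -> vector_field Y -> tangent p (nabla X Y p).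
Proof. by move=> vX vY; exact: field_tangent (vector_field_nabla vX vY). Qed.

#[local] Hint Resolve vxi vector_field_phi vector_field_nabla phi_tangent
  field_tangent nabla_tangent tangent_add tangent_sub tangent_opp tangent_scale
  tangent0 : tangents.

Lemma phi_comb p a v w : tangent p v -> tangent p w ->
  phi p (a *: v + w) = a *: phi p v + phi p w.
Proof. by move=> tv tw; rewrite (endo_field_linear (acm_phi acm)). Qed.

Lemma phiD p v w : tangent p v -> tangent p w -> phi p (v + w) = phi p v + phi p w.
Proof. by move=> tv tw; rewrite -{1}[v]scale1r phi_comb // scale1r. Qed.

Lemma phi0 p : phi p 0 = 0.
Proof.
have := phi_comb (-1) (tangent0 p) (tangent0 p).
by rewrite scaleN1r oppr0 addr0 scaleN1r addNr.
Qed.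

Lemma phiN p v : tangent p v -> phi p (- v) = - phi p v.
Proof.
move=> tv; have := phi_comb (-1) tv (tangent0 p).
by rewrite phi0 !addr0 !scaleN1r.
Qed.

Lemma phiB p v w : tangent p v -> tangent p w -> phi p (v - w) = phi p v - phi p w.
Proof. by move=> tv tw; rewrite phiD ?phiN //; exact: tangent_opp. Qed.

Lemma metric_xi p v : tangent p v -> g p v (xi p) = eta p v.
Proof. by move=> tv; rewrite (acm_eta_g acm). Qed.

(** Compatibility applied to [u] and [phi v], with phi^2 expanded; the term in xi drops out because
    eta o phi = 0. *)
Lemma phi_skew p u v : tangent p u -> tangent p v -> g p (phi p u) v = - g p u (phi p v).
Proof.
move=> tu tv; have := acm_compatible acm tu (phi_tangent tv).
rewrite (acm_phi2 acm tv) (acm_eta_phi acm tv) mulr0 subr0 => <-.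
rewrite (metricDr rg) ?(metricNr rg) ?(metricZr rg); auto with tangents.
by rewrite metric_xi ?(acm_eta_phi acm tu) ?mulr0 ?addr0 ?opprK; auto with tangents.
Qed.

Lemma phi_phi_orthogonal p v : tangent p v -> eta p v = 0 -> phi p (phi p v) = - v.
Proof. by move=> tv ev; rewrite (acm_phi2 acm tv) ev scale0r addr0. Qed.

Lemma nablaZ0r X p : vector_field X -> nabla X (fun=> 0) p = 0.
Proof.
move=> vX; have := lc_leibniz lc (smooth_fun_cst 0) vX vX p.
rewrite (tangent_cst _ (field_tangent p vX)) !scale0r addr0 => H; rewrite -[RHS]H.
by congr (nabla X _ p); apply/funext => q; rewrite scale0r.
Qed.

Lemma nabla0l Y p : vector_field Y -> nabla (fun=> 0) Y p = 0.
Proof.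
move=> vY; have v0 : vector_field (fun _ : M => (0 : functional M)).
  split=> [q|f sf]; first exact: tangent0.
  by under eq_fun do rewrite functional0; exact: smooth_fun_cst.
have := lc_linearl lc (smooth_fun_cst 1) v0 v0 vY p.
under eq_fun do rewrite scaler0 addr0.
rewrite scale1r => /eqP; rewrite -subr_eq subrr eq_sym => /eqP //.
Qed.

Lemma nablaNr X Y p : vector_field X -> vector_field Y ->
  nabla X (fun q => - Y q) p = - nabla X Y p.
Proof.
move=> vX vY; have := lc_leibniz lc (smooth_fun_cst (-1)) vX vY p.
rewrite (tangent_cst _ (field_tangent p vX)) scale0r add0r scaleN1r => <-.
by congr (nabla X _ p); apply/funext => q; rewrite scaleN1r.
Qed.

(** The covariant derivative (nabla_X phi) Y. *)
Definition dphi X Y : field M := fun p => nabla X (ph Y) p - phi p (nabla X Y p).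

Lemma vector_field_dphi X Y : vector_field X -> vector_field Y -> vector_field (dphi X Y).
Proof.
move=> vX vY; apply: vector_fieldD; first by auto with tangents.
by apply: vector_fieldN; apply: vector_field_phi; auto with tangents.
Qed.

#[local] Hint Resolve vector_field_dphi : tangents.

Let A X Y Z p := g p (dphi X Y p) (Z p).

Lemma dphiE X Y Z p : vector_field X -> vector_field Y -> vector_field Z ->
  A X Y Z p = g p (nabla X (ph Y) p) (Z p) + g p (nabla X Y p) (phi p (Z p)).
Proof.
move=> vX vY vZ; rewrite /A /dphi (metricBl rg) ?phi_skew ?opprK; auto with tangents.
Qed.

(** Differentiate g(phi Y, Z) = - g(Y, phi Z) along X. *)
Lemma dphi_skew X Y Z p : vector_field X -> vector_field Y -> vector_field Z ->
  A X Y Z p = - A X Z Y p.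
Proof.
move=> vX vY vZ; rewrite !dphiE //.
have H1 := lc_metric lc vX (vector_field_phi vY) vZ p.
have H2 := lc_metric lc vX vY (vector_field_phi vZ) p.
have E : (fun q => g q (ph Y q) (Z q)) = fun q => - g q (Y q) (ph Z q).
  by apply/funext => q; apply: phi_skew; auto with tangents.
have tX := field_tangent p vX.
rewrite E (tangentN tX) in H1; last by apply: (metric_smooth rg); auto with tangents.
have S1 : g p (phi p (Y p)) (nabla X Z p) = g p (nabla X Z p) (phi p (Y p)).
  by apply: (Defs.metric_sym rg); auto with tangents.
have S2 : g p (nabla X (ph Z) p) (Y p) = g p (Y p) (nabla X (ph Z) p).
  by apply: (Defs.metric_sym rg); auto with tangents.
rewrite {1}/ph in H1; rewrite /= -/(ph Y) in H1.
rewrite /ph in H1 H2 S1 S2 *; lra.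
Qed.

(** For a torsion-free metric connection, d Phi is the cyclic sum of (nabla_X Phi)(Y, Z) = g(Y,
    (nabla_X phi) Z). *)
Lemma dphi_cyclic X Y Z p : vector_field X -> vector_field Y -> vector_field Z ->
  A X Z Y p + A Y X Z p + A Z Y X p = 0.
Proof.
move=> vX vY vZ; have := cosymplectic_Phi cs vX vY vZ p; rewrite /d2.
rewrite (lc_metric lc vX vY (vector_field_phi vZ)).
rewrite (lc_metric lc vY vZ (vector_field_phi vX)).
rewrite (lc_metric lc vZ vX (vector_field_phi vY)).
rewrite -!(lc_torsion_free lc) // !(metricBl rg); auto with tangents.
rewrite !dphiE //.
have S U V W : vector_field U -> vector_field V -> vector_field W ->
    g p (nabla U (ph V) p) (W p) = g p (W p) (nabla U (ph V) p).
  by move=> vU vV vW; apply: (Defs.metric_sym rg); auto with tangents.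
by rewrite !S // /ph => H; lra.
Qed.

(** As d eta = 0, normality says that the Nijenhuis tensor vanishes; writing its brackets with the
    torsion-free connection leaves only derivatives of phi. *)
Lemma dphi_nijenhuis X Y p : vector_field X -> vector_field Y ->
  dphi (ph X) Y p - dphi (ph Y) X p + phi p (dphi Y X p) - phi p (dphi X Y p) = 0.
Proof.
move=> vX vY; have := cosymplectic_normal cs vX vY p.
rewrite (cosymplectic_eta cs vX vY) scale0r addr0 /nijenhuis => <-.
have [vpX vpY] := (vector_field_phi vX, vector_field_phi vY).
rewrite -(lc_torsion_free lc vX vY) -(lc_torsion_free lc vpX vpY).
rewrite -(lc_torsion_free lc vpX vY) -(lc_torsion_free lc vX vpY).
rewrite /dphi !phiB; auto with tangents.
rewrite /ph; apply/funext => f; rewrite !(functionalD, functionalN).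
ring.
Qed.

Lemma nabla_eta X Y p : vector_field X -> vector_field Y ->
  X p (fun q => eta q (Y q)) = eta p (nabla X Y p) + g p (Y p) (nabla X xi p).
Proof.
move=> vX vY; have := lc_metric lc vX vY vxi p; rewrite metric_xi; auto with tangents.
move=> <-; congr (X p _); apply/funext => q.
by rewrite metric_xi; auto with tangents.
Qed.

(** The covariant derivative of phi^2 = - I + eta (x) xi. *)
Lemma dphi_phi X Y p : vector_field X -> vector_field Y ->
  dphi X (ph Y) p + phi p (dphi X Y p) =
  g p (Y p) (nabla X xi p) *: xi p + eta p (Y p) *: nabla X xi p.
Proof.
move=> vX vY; have vpY := vector_field_phi vY.
have seta : smooth_fun (fun q => eta q (Y q)) := one_form_smooth (acm_eta acm) vY.
have phiphi : ph (ph Y) = fun q => - Y q + eta q (Y q) *: xi q.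
  by apply/funext => q; rewrite /ph (acm_phi2 acm); auto with tangents.
rewrite /dphi phiB; auto with tangents.
rewrite phiphi (lc_addr lc vX (vector_fieldN vY) (vector_fieldM seta vxi)).
rewrite nablaNr // (lc_leibniz lc seta vX vxi) nabla_eta //.
rewrite (acm_phi2 acm); auto with tangents.
rewrite /ph; apply/funext => f; rewrite !(functionalD, functionalN, functionalZ).
by ring.
Qed.

Lemma field_eq0 W p : vector_field W ->
  (forall Z, vector_field Z -> g p (W p) (Z p) = 0) -> W p = 0.
Proof. by move=> vW H; apply: (metric_eq0 rg) (H W vW); auto with tangents. Qed.

(** Since eta = g(., xi) and there is no torsion, d eta (X, Y) = g(Y, nabla_X xi) - g(X, nabla_Y
    xi). *)
Lemma nabla_xi_sym X Y p : vector_field X -> vector_field Y ->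
  g p (nabla X xi p) (Y p) = g p (nabla Y xi p) (X p).
Proof.
move=> vX vY; have := cosymplectic_eta cs vX vY p; rewrite /d1 !nabla_eta //.
rewrite -(lc_torsion_free lc vX vY) -!metric_xi ?(metricBl rg); auto with tangents.
rewrite (Defs.metric_sym rg (field_tangent p vY)); auto with tangents.
by rewrite (Defs.metric_sym rg (field_tangent p vX)); auto with tangents; lra.
Qed.

Lemma nabla_xi_xi X p : vector_field X -> eta p (nabla X xi p) = 0.
Proof.
move=> vX; have := lc_metric lc vX vxi vxi p.
have -> : (fun q => g q (xi q) (xi q)) = fun=> 1.
  by apply/funext => q; rewrite metric_xi ?(acm_eta_xi acm); auto with tangents.
rewrite (tangent_cst _ (field_tangent p vX)).
rewrite (Defs.metric_sym rg (field_tangent p vxi)); auto with tangents.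
by rewrite metric_xi; auto with tangents; lra.
Qed.

Lemma dphi_xi X p : vector_field X -> dphi X xi p = - phi p (nabla X xi p).
Proof.
move=> vX; rewrite /dphi.
have -> : ph xi = fun=> 0 by apply/funext => q; exact: (acm_phi_xi acm).
by rewrite nablaZ0r // sub0r.
Qed.

(* With [S X = nabla_X xi], normality applied to [(X, xi)] gives
   [phi (dphi xi X) = phi (S (phi X)) + S X], whereas [d Phi = 0] applied to
   [(X, Y, xi)] gives [dphi xi X = - S (phi X) - phi (S X)]; hence
   [phi (S (phi X)) = 0]. *)
Lemma nabla_xi_phi X p : vector_field X -> nabla (ph X) xi p = 0.
Proof.
move=> vX; have vpX := vector_field_phi vX.
have tS Y : vector_field Y -> tangent p (nabla Y xi p) by auto with tangents.
have H1 : phi p (dphi xi X p) = phi p (nabla (ph X) xi p) + nabla X xi p.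
  have := dphi_nijenhuis p vX vxi; rewrite !dphi_xi //.
  have -> : dphi (ph xi) X p = 0.
    have -> : ph xi = fun=> 0 by apply/funext => q; exact: (acm_phi_xi acm).
    by rewrite /dphi !nabla0l ?phi0 ?subr0; auto with tangents.
  rewrite phiN; last by auto with tangents.
  rewrite phi_phi_orthogonal ?nabla_xi_xi; auto with tangents.
  rewrite opprK subr0 => /eqP; rewrite subr_eq0 addrC subr_eq => /eqP ->.
  by rewrite addrC.
have H2 : dphi xi X p = - nabla (ph X) xi p - phi p (nabla X xi p).
  pose W q := dphi xi X q + (nabla (ph X) xi q + phi q (nabla X xi q)).
  have vW : vector_field W.
    apply: vector_fieldD; first by auto with tangents.
    by apply: vector_fieldD; [|apply: vector_field_phi]; auto with tangents.
  suff : W p = 0 by rewrite /W => /eqP; rewrite addr_eq0 opprD => /eqP.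
  apply: field_eq0 => // Y vY.
  have tD : tangent p (dphi xi X p) by auto with tangents.
  rewrite /W (metricDl rg tD) 1?(metricDl rg (tS _ vpX)); auto with tangents.
  have := dphi_cyclic p vX vY vxi.
  rewrite (dphi_skew _ vY vX vxi) (dphi_skew _ vxi vY vX).
  rewrite /A !dphi_xi // !(metricNl rg); auto with tangents.
  have := nabla_xi_sym p vpX vY; have := phi_skew (tS _ vY) (field_tangent p vX).
  by rewrite /ph; lra.
have H3 : phi p (nabla (ph X) xi p) = 0.
  have : phi p (dphi xi X p) = - phi p (nabla (ph X) xi p) + nabla X xi p.
    rewrite H2 phiB ?phiN; auto with tangents.
    by rewrite phi_phi_orthogonal ?nabla_xi_xi ?opprK; auto with tangents.
  rewrite H1 => /addIr /eqP; rewrite -subr_eq0 opprK -mulr2n -scaler_nat.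
  by rewrite scaler_eq0 pnatr_eq0 => /eqP.
(* The vector is orthogonal to xi, where phi^2 = - I, so phi can be cancelled. *)
have := phi_phi_orthogonal (tS _ vpX) (nabla_xi_xi p vpX).
by rewrite H3 phi0 => /eqP; rewrite eq_sym oppr_eq0 => /eqP.
Qed.

(** Self-adjointness of S = nabla xi and S o phi = 0 give g(phi (S X), Y) = - g(S X, phi Y) = - g(S
    (phi Y), X) = 0 for every Y; and phi is injective on S X, which is orthogonal to xi. *)
Lemma nabla_xi0 X p : vector_field X -> nabla X xi p = 0.
Proof.
move=> vX; have tS : tangent p (nabla X xi p) by auto with tangents.
suff H : phi p (nabla X xi p) = 0.
  have := phi_phi_orthogonal tS (nabla_xi_xi p vX).
  by rewrite H phi0 => /eqP; rewrite eq_sym oppr_eq0 => /eqP.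
apply: (@field_eq0 (ph (nabla X xi))) => [|Y vY]; first by auto with tangents.
rewrite phi_skew; auto with tangents.
rewrite (nabla_xi_sym p vX (vector_field_phi vY)) nabla_xi_phi //.
by rewrite (metric0l rg) ?oppr0; auto with tangents.
Qed.

(* [B (X, Y, Z) = A (phi X, Y, Z) + A (X, Y, phi Z)] is symmetric in [X, Y] and skew
   in [Y, Z], hence zero; then [C (X, Y, Z) = A (X, Y, phi Z)] satisfies
   [C (X, Y, Z) = C (Y, Z, X) + C (Z, X, Y)] and vanishes too. *)
Lemma cosymplectic_parallel_phi X Y p : vector_field X -> vector_field Y ->
  nabla X (fun q => phi q (Y q)) p = phi p (nabla X Y p).
Proof.
(* With xi parallel, the right-hand side of [dphi_phi] vanishes: (nabla_U phi) anticommutes with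
   phi. As phi is skew, it may thus be moved between the last two arguments of [A]. *)
have dphiphi U V q : vector_field U -> vector_field V ->
    dphi U (ph V) q = - phi q (dphi U V q).
  move=> vU vV; have := dphi_phi q vU vV; rewrite nabla_xi0 // scaler0 addr0.
  rewrite (Defs.metric_sym rg) ?(metric0l rg) ?scale0r; auto with tangents.
  by move=> /eqP; rewrite addr_eq0 => /eqP.
have phiA U V W q : vector_field U -> vector_field V -> vector_field W ->
    g q (phi q (dphi U V q)) (W q) = - A U V (ph W) q.
  by move=> vU vV vW; rewrite phi_skew; auto with tangents.
have A23 U V W q : vector_field U -> vector_field V -> vector_field W ->
    A U (ph V) W q = A U V (ph W) q.
  move=> vU vV vW; rewrite {1}/A dphiphi // (metricNl rg) ?phiA ?opprK; auto with tangents.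
pose B U V W q := A (ph U) V W q + A U V (ph W) q.
(* This is [dphi_nijenhuis] paired with W. *)
have Bsym U V W q : vector_field U -> vector_field V -> vector_field W ->
    B U V W q = B V U W q.
  move=> vU vV vW.
  have : g q (dphi (ph U) V q - dphi (ph V) U q + phi q (dphi V U q)
      - phi q (dphi U V q)) (W q) = 0.
    by rewrite dphi_nijenhuis // (metric0l rg); auto with tangents.
  have td1 : tangent q (dphi (ph U) V q) by auto with tangents.
  have td2 : tangent q (dphi (ph V) U q) by auto with tangents.
  have td3 : tangent q (dphi V U q) by auto with tangents.
  have td4 : tangent q (dphi U V q) by auto with tangents.
  rewrite (metricBl rg _ (phi_tangent td4)) ?(metricDl rg _ (phi_tangent td3));
    auto with tangents.
  rewrite (metricBl rg td1 td2) ?phiA /B /A; auto with tangents.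
  by move=> H; lra.
have Bskew U V W q : vector_field U -> vector_field V -> vector_field W ->
    B U V W q = - B U W V q.
  move=> vU vV vW; rewrite /B (dphi_skew _ (vector_field_phi vU) vV vW).
  by rewrite -A23 // (dphi_skew _ vU (vector_field_phi vV) vW) opprD.
have B0 U V W q : vector_field U -> vector_field V -> vector_field W ->
    A (ph U) V W q = - A U V (ph W) q.
  move=> vU vV vW; suff : B U V W q = 0 by rewrite /B; lra.
  have := Bsym U V W q vU vV vW; have := Bskew V U W q vV vU vW.
  have := Bsym V W U q vV vW vU; have := Bskew W V U q vW vV vU.
  by have := Bsym W U V q vW vU vV; have := Bskew U W V q vU vW vV; lra.
have Ccyc U V W q : vector_field U -> vector_field V -> vector_field W ->
    A U V (ph W) q = A V W (ph U) q + A W U (ph V) q.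
  move=> vU vV vW; have := dphi_cyclic q (vector_field_phi vU) vV vW.
  rewrite B0 // A23 //.
  have := dphi_skew q vU vV (vector_field_phi vW); rewrite A23 //.
  have := dphi_skew q vV vW (vector_field_phi vU); rewrite A23 //.
  have := dphi_skew q vW vU (vector_field_phi vV); rewrite A23 //.
  by lra.
have C0 U V W q : vector_field U -> vector_field V -> vector_field W ->
    A U V (ph W) q = 0.
  (* The three cyclic instances add up to s = 2 s for the cyclic sum s, so s = 0; each instance also
     reads C = s - C, whence C = 0. *)
  move=> vU vV vW; have := Ccyc U V W q vU vV vW; have := Ccyc V W U q vV vW vU.
  by have := Ccyc W U V q vW vU vV; lra.
move=> vX vY; have vD := vector_field_dphi vX vY.
apply/eqP; rewrite -subr_eq0; apply/eqP; apply: (@field_eq0 (dphi X Y)) => // Z vZ.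
(* Replacing Z by phi Z makes phi^2 Z = - Z + eta(Z) xi appear; the component along xi contributes
   nothing because xi is parallel. *)
have := C0 X Y (ph Z) p vX vY (vector_field_phi vZ).
have Axi : g p (dphi X Y p) (xi p) = 0.
  rewrite -/(A X Y xi p) dphi_skew // /A dphi_xi // nabla_xi0 // phi0 oppr0.
  by rewrite (metric0l rg) ?oppr0; auto with tangents.
rewrite /A /ph (acm_phi2 acm) ?(metricDr rg) ?(metricNr rg) ?(metricZr rg); auto with tangents.
by rewrite Axi mulr0 addr0 => /eqP; rewrite oppr_eq0 => /eqP.
Qed.

End Cosymplectic.

(** * The horizontal distribution *)

Theorem theorem16 (R : realType) (k n : nat)
  (M : smooth_manifold R k.*2.+1) (N : smooth_manifold R n)
  (phi : M -> functional M -> functional M) (xi : field M)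
  (eta : M -> functional M -> R)
  (gM : M -> functional M -> functional M -> R)
  (gN : N -> functional N -> functional N -> R)
  (nabla : field M -> field M -> field M) (F : M -> N) :
  cosymplectic phi xi eta gM ->
  riemannian_metric gN ->
  levi_civita gM nabla ->
  riemannian_submersion F gM gN ->
  (forall p, direct_sum (horizontal F gM p)
               (phi p @` vertical F p) (line xi p)) ->
  integrable_distribution (horizontal F gM) /\
  totally_geodesic nabla (horizontal F gM).
Proof.
move=> cs rN lc sub dsum; have acm := cosymplectic_acm cs; have rM := acm_g acm.
have vxi := acm_xi acm.
have vertical0 p : vertical F p 0.
  split; first exact: tangent0.
  by apply/funext => h; rewrite /Defs.pushforward; case: ifP.
have horizontal_phi p w : vertical F p w -> horizontal F gM p (phi p w).
  move=> vw; rewrite (dsum p).1; exists (phi p w); first by exists w.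
  exists 0; last by rewrite addr0.
  by exists 0 => //; rewrite scale0r.
have horizontal_xi p : horizontal F gM p (xi p).
  rewrite (dsum p).1; exists 0.
    by exists 0 => //; rewrite (phi0 cs).
  by exists (xi p); [exists 1; rewrite ?scale1r|rewrite add0r].
have eta_vertical p w : vertical F p w -> eta p w = 0.
  move=> vw; rewrite (acm_eta_g acm vw.1).
  exact: (vertical_horizontal rM (horizontal_xi p) vw).
have phi_phi_vertical p w : vertical F p w -> phi p (phi p w) = - w.
  by move=> vw; rewrite (acm_phi2 acm vw.1) eta_vertical // scale0r addr0.
have verticalN p w : vertical F p w -> vertical F p (- w).
  move=> [tw Fw]; split; first exact: tangent_opp.
  apply/funext => h; have := congr1 (fun v : functional N => v h) Fw.
  by rewrite /Defs.pushforward; case: ifP => // _; rewrite functionalN => ->; rewrite oppr0.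
(* Write z = phi u + a xi with u vertical. Since xi is horizontal, eta(u) = 0, and phi z = phi^2 u =
   - u. *)
have vertical_phi p z : horizontal F gM p z -> vertical F p (phi p z).
  rewrite (dsum p).1 => -[_ [u vu <-] [_ [a _ <-] <-]].
  rewrite (phiD cs); last 2 first.
  - by apply: (phi_tangent cs); exact: vu.1.
  - by apply: tangent_scale; exact: field_tangent vxi.
  rewrite phi_phi_vertical // -[a *: xi p]addr0 (phi_comb cs) ?(phi0 cs).
  - by rewrite (acm_phi_xi acm) scaler0 !addr0; exact: verticalN.
  - exact: field_tangent vxi.
  - exact: tangent0.
have section_phi Z : section_of (horizontal F gM) Z ->
    section_of (vertical F) (fun q => phi q (Z q)).
  move=> [vZ hZ]; split=> [|q]; last exact: vertical_phi.
  exact: (vector_field_phi cs).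
pose T X Y Z p := gM p (nabla X Y p) (phi p (Z p)).
have Tskew X Y Z p : section_of (horizontal F gM) X ->
    section_of (horizontal F gM) Y -> section_of (horizontal F gM) Z ->
    T X Y Z p = - T Y X Z p.
  by move=> sX sY sZ; apply: (nabla_skew rM rN sub lc p (section_phi _ sZ)).
(* [g (nabla_X Y, phi Z) = - g (nabla_X (phi Y), Z) = g (phi Y, nabla_X Z)], as
   [phi Y] is vertical and [Z] horizontal. *)
have Tsym X Y Z p : section_of (horizontal F gM) X ->
    section_of (horizontal F gM) Y -> section_of (horizontal F gM) Z ->
    T X Y Z p = T X Z Y p.
  move=> sX sY sZ; rewrite /T; have [vX vY vZ] := And3 sX.1 sY.1 sZ.1.
  have vpY := vector_field_phi cs vY.
  have tXY := nabla_tangent lc p vX vY; have tXZ := nabla_tangent lc p vX vZ.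
  have tpY := phi_tangent cs (field_tangent p vY).
  have := lc_metric lc vX vpY vZ p.
  have -> : (fun q => gM q (phi q (Y q)) (Z q)) = fun=> 0.
    apply/funext => q; apply: (vertical_horizontal rM (sZ.2 q)).
    exact: vertical_phi (sY.2 q).
  rewrite (tangent_cst _ (field_tangent p vX)) (cosymplectic_parallel_phi cs lc p vX vY).
  rewrite (phi_skew cs tXY (field_tangent p vZ)) (Defs.metric_sym rM tpY tXZ).
  by move=> /esym/eqP; rewrite addrC subr_eq0 => /eqP.
have T0 X Y Z p : section_of (horizontal F gM) X ->
    section_of (horizontal F gM) Y -> section_of (horizontal F gM) Z ->
    T X Y Z p = 0.
  move=> sX sY sZ.
  (* Alternating the two transpositions six times leads back to T(X, Y, Z) after three changes of
     sign. *)
  have := Tskew X Y Z p sX sY sZ; have := Tsym Y X Z p sY sX sZ.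
  have := Tskew Y Z X p sY sZ sX; have := Tsym Z Y X p sZ sY sX.
  have := Tskew Z X Y p sZ sX sY; have := Tsym X Z Y p sX sZ sY.
  by lra.
have geodesic : totally_geodesic nabla (horizontal F gM).
  move=> X Y sX sY; have vXY := lc_field lc sX.1 sY.1.
  split=> // p; have tXY := field_tangent p vXY; split=> // w vw.
  (* [T] takes sections, so [phi w] is first extended to a horizontal field [Z]; at [p] the second
     phi turns T(X, Y, Z) into minus the pairing of nabla_X Y with [w]. *)
  have [Z sZ Zw] := horizontal_extension rM sub (horizontal_phi _ _ vw).
  have := T0 X Y Z p sX sY sZ; rewrite /T Zw phi_phi_vertical //.
  by rewrite (metricNr rM vw.1 tXY) => /eqP; rewrite oppr_eq0 => /eqP.
split=> // X Y sX sY; split; first exact: vector_field_bracket sX.1 sY.1.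
move=> p; rewrite -(lc_torsion_free lc sX.1 sY.1).
have [_ /(_ p) hXY] := geodesic X Y sX sY; have [_ /(_ p) hYX] := geodesic Y X sY sX.
split=> [|w vw]; first exact: tangent_sub hXY.1 hYX.1.
rewrite (metricBl rM hXY.1 hYX.1 vw.1).
by rewrite (horizontal_vertical hXY vw) (horizontal_vertical hYX vw) subrr.
Qed.
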